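(* Let $k$ be an algebraically closed field of characteristic $0$, let $N\geq 2$ and $n\geq 1$. For any set $X$ of $n$ very general points in $\mathbb{P}^N_k$ one has $$\epsilon(N,X)\geq \sqrt[N-1]{\frac{\alpha(X)+N-1}{nN}}.$$
   Context: For a finite set $X=\{\mathfrak{p}_1,\ldots,\mathfrak{p}_n\}$ of distinct points in $\mathbb{P}^N_k$, $\alpha(X)$ is the minimum degree of a hypersurface in $\mathbb{P}^N_k$ passing through every point of $X$, and the multipoint Seshadri constant is $$\epsilon(N,X)=\sqrt[N-1]{\inf\left\{\frac{\deg(F)}{\sum_{i=1}^n \mathrm{mult}_{\mathfrak{p}_i}(F)}\right\}},$$ where the infimum is over all hypersurfaces $F$ passing through at least one of the $\mathfrak{p}_i$. Very general points: let $G(1,n,N+1)\cong \mathrm{Sym}^n(\mathbb{P}_k^N)=(\mathbb{P}^N_k)^n/S_n$ be the Chow variety of $0$-cycles of degree $n$ in $\mathbb{P}_k^N$. A property $\mathcal{P}$ holds for $n$ very general points in $\mathbb{P}_k^N$ if there is a nonempty subset $W\subseteq G(1,n,N+1)$ of the form $W=\bigcap_{i=1}^\infty U_i$, with each $U_i$ a dense Zariski-open subset, such that $\mathcal{P}$ holds for every set $X=\{p_1,\ldots,p_n\}$ of $n$ (distinct) points with $p_1+\cdots+p_n\in W$. *)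

(* Defs.v *)
From HB Require Import structures.
From mathcomp Require Import all_boot all_order all_algebra.
From mathcomp Require Import generic_quotient mpoly.
From mathcomp Require Import boolp classical_sets.
From mathcomp Require Import topology_structure quotient_topology.
From mathcomp Require Import reals exp.

Set Implicit Arguments.
Unset Strict Implicit.
Unset Printing Implicit Defensive.

Import Order.TTheory GRing.Theory Num.Theory.
Local Open Scope classical_set_scope.
Local Open Scope quotient_scope.
Local Open Scope ring_scope.

(* P^N_k: its (closed) points are the lines through 0 in k^(N+1). *)
Definition pspace (k : fieldType) (N : nat) : Type :=
  {L : {vspace 'rV[k]_N.+1} | \dim L == 1%N}.
HB.instance Definition _ (k : fieldType) (N : nat) :=
  Choice.copy (pspace k N) {L : {vspace 'rV[k]_N.+1} | \dim L == 1%N}.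

(* A hypersurface is represented by a defining form, unique up to scaling. *)
Definition hypersurface (k : fieldType) (N d : nat) (F : {mpoly k[N.+1]}) : Prop :=
  [/\ F != 0, (0 < d)%N & F \is d.-homog].

Definition point_ideal (k : fieldType) (N : nat) (p : pspace k N) :
    set {mpoly k[N.+1]} :=
  [set F | forall v, v \in val p -> F.@[v 0] = 0].

Definition ideal_power (A : comNzRingType) (I : set A) (m : nat) : set A :=
  [set x | exists2 s : seq (A * m.-tuple A),
      (forall u, u \in s -> forall i, I (tnth u.2 i))
    & x = \sum_(u <- s) u.1 * \prod_(i < m) tnth u.2 i].

(* I(p)^m S_(I(p)) `&` S, where S is the polynomial ring: the F whose germ at
   p lies in the m-th power of the maximal ideal of the local ring at p. *)
Definition symbolic_power (k : fieldType) (N : nat) (p : pspace k N) (m : nat) :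
    set {mpoly k[N.+1]} :=
  [set F | exists2 g, ~ point_ideal p g & ideal_power (point_ideal p) m (g * F)].

(* For F != 0 there is exactly one such m, since the symbolic powers form a
   decreasing chain with intersection 0. *)
Definition mult (k : fieldType) (N : nat) (p : pspace k N)
    (F : {mpoly k[N.+1]}) : nat :=
  xget 0%N [set m | symbolic_power p m F /\ ~ symbolic_power p m.+1 F].

Definition hypersurface_through (k : fieldType) (N : nat) (X : seq (pspace k N))
    (d : nat) : Prop :=
  exists2 F : {mpoly k[N.+1]}, hypersurface d F
    & forall p, p \in X -> point_ideal p F.

Definition alpha (k : fieldType) (N : nat) (X : seq (pspace k N)) : nat :=
  xget 0%N [set d | hypersurface_through X d
                  /\ forall e, hypersurface_through X e -> (d <= e)%N].

Definition seshadri (R : realType) (k : fieldType) (N : nat)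
    (X : seq (pspace k N)) : R :=
  inf [set r : R | exists d (F : {mpoly k[N.+1]}),
         [/\ hypersurface d F,
             exists2 p, p \in X & point_ideal p F
           & r = d%:R / (\sum_(p <- X) mult p F)%:R]]
    `^ (N.-1%:R)^-1.

(* The coordinates of (P^N)^n are n groups of N+1 variables; the j-th
   homogeneous coordinate of the i-th factor is the variable number
   mxvec_index i j. *)
Definition multihomog (k : fieldType) (N n : nat)
    (G : {mpoly k[(n * N.+1)%N]}) : Prop :=
  exists e : 'I_n -> nat, forall m : 'X_{1.. (n * N.+1)%N}, m \in msupp G ->
    forall i, (\sum_(j < N.+1) m (mxvec_index i j))%N = e i.

Definition pspace_pow (k : fieldType) (N n : nat) : Type := n.-tuple (pspace k N).
HB.instance Definition _ (k : fieldType) (N n : nat) :=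
  Choice.copy (pspace_pow k N n) (n.-tuple (pspace k N)).

(* vpick L is a nonzero vector of the line L; whether a multihomogeneous G
   vanishes does not depend on this choice of homogeneous coordinates. *)
Definition mheval (k : fieldType) (N n : nat) (G : {mpoly k[(n * N.+1)%N]})
    (x : pspace_pow k N n) : k :=
  G.@[mxvec (\matrix_(i < n) vpick (val (tnth x i))) 0].

Definition zariski_open (k : fieldType) (N n : nat) :
    set (set (pspace_pow k N n)) :=
  [set U | exists2 S : set {mpoly k[(n * N.+1)%N]},
      (forall G, S G -> multihomog G)
    & ~` U = [set x | forall G, S G -> mheval G x = 0]].

Lemma zariski_openT (k : fieldType) (N n : nat) :
  zariski_open [set: pspace_pow k N n].
Proof.
exists [set 1]; last first.
  rewrite setCT; apply/seteqP; split=> x //= /(_ 1 erefl) /eqP.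
  by rewrite /mheval rmorph1 oner_eq0.
move=> _ ->; exists (fun=> 0%N) => m; rewrite msupp1 inE => /eqP -> i.
by rewrite big1 // => j _; rewrite mnm0E.
Qed.

Lemma multihomogM (k : fieldType) (N n : nat) (G H : {mpoly k[(n * N.+1)%N]}) :
  multihomog G -> multihomog H -> multihomog (G * H).
Proof.
move=> [a Ga] [b Hb]; exists (fun i => a i + b i)%N => m /msuppM_le.
case/allpairsP=> -[m1 m2] /= [/Ga m1a /Hb m2b ->] i.
rewrite -(m1a i) -(m2b i) -big_split /=.
by apply: eq_bigr => j _; rewrite mnmDE.
Qed.

Lemma zariski_openI (k : fieldType) (N n : nat) :
  setI_closed (@zariski_open k N n).
Proof.
move=> U V [S Sh US] [T Th VT].
exists [set G * H | G in S & H in T].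
  by move=> _ [G SG [H TH <-]]; apply: multihomogM; [apply: Sh|apply: Th].
rewrite setCI US VT; apply/seteqP; split=> x /=.
  by move=> [Sx|Tx] _ [G SG [H TH <-]]; rewrite /mheval rmorphM /=;
    [rewrite [G.@[_]](Sx _ SG) mul0r|rewrite [H.@[_]](Tx _ TH) mulr0].
move=> GHx;
have [Sx|] := pselect (forall G, S G -> mheval G x = 0); first by left.
move=> /existsNP[G /not_implyP[SG /eqP Gx]]; right=> H TH.
have := GHx _ (ex_intro2 _ _ G SG (ex_intro2 _ _ H TH erefl)).
rewrite /mheval rmorphM /= => /eqP; rewrite mulf_eq0.
by move: Gx; rewrite /mheval => /negbTE -> /eqP.
Qed.

Lemma zariski_open_bigU (k : fieldType) (N n : nat) (I : Type)
    (f : I -> set (pspace_pow k N n)) :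
  (forall i, zariski_open (f i)) -> zariski_open (\bigcup_i f i).
Proof.
move=> fo; have /choice[S] : forall i, exists S : set {mpoly k[(n * N.+1)%N]},
    (forall G, S G -> multihomog G)
    /\ ~` f i = [set x | forall G, S G -> mheval G x = 0].
  by move=> i; have [S ? ?] := fo i; exists S.
move=> fS; exists (\bigcup_i S i).
  by move=> G [i _ SG]; apply: (fS i).1.
rewrite setC_bigcup; apply/seteqP; split=> x /=.
  by move=> fx G [i _ SG]; have := fx i Logic.I; rewrite (fS i).2; apply.
by move=> Sx i _; rewrite (fS i).2 => G SG; apply: Sx; exists i.
Qed.

HB.instance Definition _ (k : fieldType) (N n : nat) :=
  isOpenTopological.Build (pspace_pow k N n) (@zariski_openT k N n)
    (@zariski_openI k N n) (@zariski_open_bigU k N n).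

(* Two n-tuples of points have the same orbit under S_n. *)
Definition same_cycle (k : fieldType) (N n : nat) : rel (pspace_pow k N n) :=
  fun x y => perm_eq x y.

Lemma same_cycle_equiv (k : fieldType) (N n : nat) :
  equiv_class_of (@same_cycle k N n).
Proof.
split=> [x|x y|y x z]; rewrite /same_cycle; first exact: perm_refl.
  exact: perm_sym.
exact: perm_trans.
Qed.

Canonical same_cycle_equiv_rel (k : fieldType) (N n : nat) :=
  EquivRelPack (same_cycle_equiv k N n).

(* Sym^n(P^N) = (P^N)^n / S_n with the quotient of the Zariski topology; the
   class of (p_1, ..., p_n) is the 0-cycle p_1 + ... + p_n. *)
Definition chow0 (k : fieldType) (N n : nat) : topologicalType :=
  quotient_topology {eq_quot (@same_cycle k N n)}.

Definition cycle_of (k : fieldType) (N n : nat) (x : n.-tuple (pspace k N)) :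
    chow0 k N n :=
  \pi_({eq_quot (@same_cycle k N n)}) (x : pspace_pow k N n).

Definition very_general (k : fieldType) (N n : nat)
    (P : n.-tuple (pspace k N) -> Prop) : Prop :=
  exists U : nat -> set (chow0 k N n),
    [/\ forall i, open (U i) /\ dense (U i),
        \bigcap_i U i !=set0
      & forall x : n.-tuple (pspace k N),
          uniq x -> (\bigcap_i U i) (cycle_of x) -> P x].

(* Main.v *)
Require Import Defs.
From mathcomp Require Import all_boot all_order all_fingroup all_algebra.
From mathcomp Require Import generic_quotient mpoly.
From mathcomp Require Import boolp classical_sets cardinality.
From mathcomp Require Import topology_structure quotient_topology.
From mathcomp Require Import reals exp.
From mathcomp Require Import zify.

Set Implicit Arguments.
Unset Strict Implicit.
Unset Printing Implicit Defensive.

Import Order.TTheory GRing.Theory Num.Theory.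
Local Open Scope classical_set_scope.
Local Open Scope quotient_scope.
Local Open Scope ring_scope.

(** Choose [a] with ['C(a - 1 + N, N) <= n < 'C(a + N, N)].  Counting
    conditions gives [alpha X <= a] for every [X], so it suffices that very
    general points carry no form of degree [d] with multiplicities [m i] when
    [d * n * N < (a - 1 + N) * \sum_i m i].  For fixed [d] and [m] this is an
    open condition.  If it failed everywhere, multiplying the forms obtained
    from the cyclic shifts of the points would give a form of degree [n * d]
    vanishing to order [\sum_i m i] at each of [n] arbitrary points.  Put the
    first ['C(s, N)] of them, [s = a - 1 + N], at a star configuration, the
    N-fold intersections of [s] hyperplanes in general position: there the
    multiplicities of a form of degree [D] add up to at most
    [D * 'C(s - 1, N - 1)], by induction on [N] through restriction to the
    hyperplanes.  Over an uncountable field countably many nonempty open sets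
    have a common point. *)

(** * Avoiding the roots of a family of univariate polynomials *)

(** Isolates how the size of [k] enters: it holds for finite [T] in characteristic 0, and for
    countable [T] over an uncountable field. *)
Definition common_nonroots (k : fieldType) (T : Type) : Prop :=
  forall p : T -> {poly k}, (forall i, p i != 0) ->
  exists c, forall i, (p i).[c] != 0.

Lemma natr_inj (k : fieldType) : [pchar k] =i pred0 -> injective (fun i : nat => i%:R : k).
Proof.
move=> char0 i j ij; wlog le_ij : i j ij / (i <= j)%N.
  by move=> W; case/orP: (leq_total i j) => h; [|apply/esym]; apply: W.
apply/eqP; rewrite eqn_leq le_ij /= -subn_eq0.
by rewrite -((pcharf0P _).1 char0) natrB // ij subrr.
Qed.

Lemma common_nonroots_fin (k : fieldType) (T : finType) :
  [pchar k] =i pred0 -> common_nonroots k T.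
Proof.
move=> char0 p p0; pose q := \prod_i p i.
have q0 : q != 0 by apply/prodf_neq0 => i _.
pose s := [seq i%:R : k | i <- iota 0 (size q)].
have us : uniq s by rewrite (map_inj_uniq (natr_inj char0)) iota_uniq.
have : ~~ all (root q) s.
  apply/negP => rs; have := max_poly_roots q0 rs us.
  by rewrite size_map size_iota ltnn.
case/allPn => c _ qc; exists c => i; apply: contra qc => pc.
by rewrite /root horner_prod (bigD1 i) //= (eqP pc) mul0r.
Qed.

(** Each root set is finite, so countably many of them cannot cover an uncountable field. *)
Lemma common_nonroots_count (k : fieldType) (T : countType) :
  ~ countable [set: k] -> common_nonroots k T.
Proof.
move=> ck p p0; apply/not_existsP => H; apply: ck.
have cU : countable (\bigcup_(i in [set: T]) [set c | root (p i) c]).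
  apply: bigcup_countable => // i _; apply: finite_set_countable.
  apply: contrapT => inf_roots.
  have [B Bp sB] := infinite_set_fset (size (p i)) inf_roots.
  have rB : all (root (p i)) (finmap.enum_fset B) by apply/allP => x /Bp.
  by have := max_poly_roots (p0 i) rB (finmap.fset_uniq B); rewrite ltnNge sB.
apply: sub_countable cU; apply: subset_card_le => c _.
have /existsNP[i] := H c.
by move=> /negP; rewrite negbK => pc; exists i.
Qed.

(** * Nonvanishing of polynomials at vectors and on lines *)

Lemma rmorph_mmap (n : nat) (R : nzRingType) (S T : comNzRingType)
    (phi : {rmorphism S -> T}) (f : R -> S) (h : 'I_n -> S) (F : {mpoly R[n]}) :
  phi (mmap f h F) = mmap (phi \o f) (phi \o h) F.
Proof.
rewrite /mmap rmorph_sum; apply: eq_bigr => m _; rewrite rmorphM /mmap1.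
by rewrite rmorph_prod; congr (_ * _); apply: eq_bigr => i _; rewrite rmorphXn.
Qed.

Lemma eq_mmap (n : nat) (R S : nzRingType) (f f' : R -> S) (h h' : 'I_n -> S)
    (F : {mpoly R[n]}) : f =1 f' -> h =1 h' -> mmap f h F = mmap f' h' F.
Proof.
move=> ff hh; rewrite /mmap; apply: eq_bigr => m _.
by rewrite ff; congr (_ * _); apply: mmap1_eq.
Qed.

Lemma coef_muni (n : nat) (R : nzRingType) (F : {mpoly R[n.+1]}) (m : 'X_{1..n.+1}) :
  ((muni F)`_(m ord_max))@_[multinom m (widen_ord (leqnSn n) i) | i < n] = F@_m.
Proof.
rewrite muniE coef_sum raddf_sum /= [in RHS](mpolyE F) raddf_sum /=.
apply: eq_bigr => u _.
rewrite coefZ coefXn mulr_natr mcoeffMn mcoeffZ mcoeffX mcoeffZ mcoeffX.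
have [->|um] := eqVneq u m; first by rewrite !eqxx.
have [e1|//] := eqVneq (m ord_max) (u ord_max); last by rewrite mulr0n mulr0.
have [e2|] := eqVneq; last by rewrite mulr0.
case/eqP: um; apply/mnmP => i; case: (unliftP ord_max i) => [j ->|->]; last by rewrite e1.
have /mnmP/(_ j) := e2; rewrite !mnmE.
suff -> : widen_ord (leqnSn n) j = lift ord_max j by [].
by apply/val_inj; rewrite /= /bump leqNgt ltn_ord.
Qed.

Lemma horner_muni (n : nat) (R : comNzRingType) (F : {mpoly R[n.+1]})
    (v : 'I_n.+1 -> R) :
  (map_poly (meval (fun i => v (widen_ord (leqnSn n) i))) (muni F)).[v ord_max] =
  F.@[v].
Proof.
rewrite muniE raddf_sum horner_sum mevalE; apply: eq_bigr => u _ /=.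
rewrite map_polyZ map_polyXn hornerZ hornerXn /= mevalZ mevalX big_ord_recr /= mulrA.
by congr (_ * _ * _); apply: eq_bigr => i _; rewrite mnmE.
Qed.

(** Some coefficient of [muni F] is nonzero at a vector by induction on the number of variables; the
    last coordinate is then chosen off the roots of the resulting univariate polynomial. *)
Lemma mpoly_nonvanishing (k : fieldType) (n : nat) (F : {mpoly k[n]}) :
  [pchar k] =i pred0 -> F != 0 -> exists v, F.@[v] != 0.
Proof.
move=> char0; elim: n F => [|n IHn] F.
  rewrite -msupp_eq0; case E: (msupp F) => [//|m s] _; exists (fun=> 0).
  rewrite mevalE E; have s0 : s = [::].
    case: s E => // m' s E; have := msupp_uniq F; rewrite E /= inE.
    suff -> : m = m' by rewrite eqxx.
    by apply/mnmP; case.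
  by rewrite s0 big_seq1 big_ord0 mulr1 -mcoeff_msupp E inE eqxx.
rewrite -msupp_eq0; case E: (msupp F) => [//|m s] _.
have : F@_m != 0 by rewrite -mcoeff_msupp E inE eqxx.
rewrite -coef_muni => Fm.
have /IHn[v] : (muni F)`_(m ord_max) != 0.
  by apply: contraNneq Fm => ->; rewrite mcoeff0.
rewrite -coef_map => /= qm; set q := map_poly _ _ in qm.
have q0 : q != 0 by apply: contraNneq qm => ->; rewrite coef0.
have [t /(_ tt) qt] := common_nonroots_fin char0 (fun _ : unit => q0).
exists (fun i => if unlift ord_max i is Some j then v j else t).
rewrite -horner_muni unlift_none; rewrite (_ : map_poly _ _ = q) //.
apply/polyP => i; rewrite !coef_map /=; apply: meval_eq => j.
suff -> : widen_ord (leqnSn n) j = lift ord_max j by rewrite liftK.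
by apply/val_inj; rewrite /= /bump leqNgt ltn_ord.
Qed.

Definition line_restr (k : fieldType) (n : nat) (F : {mpoly k[n]})
    (v w : 'I_n -> k) : {poly k} :=
  mmap polyC (fun i => (v i)%:P + w i *: 'X) F.

Lemma horner_line_restr (k : fieldType) (n : nat) (F : {mpoly k[n]})
    (v w : 'I_n -> k) (t : k) :
  (line_restr F v w).[t] = F.@[fun i => v i + t * w i].
Proof.
rewrite -[LHS]/(horner_eval t _) /line_restr rmorph_mmap.
apply: eq_mmap => [c|i] /=; rewrite /horner_eval ?hornerE //.
by rewrite mulrC.
Qed.

(* Moving one coordinate at a time to a value that keeps every member of the
   family nonvanishing somewhere on the remaining affine space. *)
Lemma common_nonvanishing (k : fieldType) (n : nat) (T : Type)
    (G : T -> {mpoly k[n]}) :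
  common_nonroots k T -> (forall i, exists v, (G i).@[v] != 0) ->
  exists v, forall i, (G i).@[v] != 0.
Proof.
move=> cnr Gv.
have H j : exists a : 'I_n -> k, forall i, exists2 v,
    (forall l : 'I_n, (l < j)%N -> v l = a l) & (G i).@[v] != 0.
  elim: j => [|j [a Ha]].
    by exists (fun=> 0) => i; have [v] := Gv i; exists v.
  have [nj|jn] := leqP n j.
    exists a => i; have [v va Gi] := Ha i; exists v => // l _.
    by apply: va; apply: leq_trans nj.
  pose jo := Ordinal jn.
  have /choice[v Hv] : forall i, exists v,
      (forall l : 'I_n, (l < j)%N -> v l = a l) /\ (G i).@[v] != 0.
    by move=> i; have [v] := Ha i; exists v.
  pose p i := line_restr (G i) (fun l => if l == jo then 0 else v i l)
                               (fun l => (l == jo)%:R).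
  have pE i t : (p i).[t] = (G i).@[fun l => if l == jo then t else v i l].
    rewrite horner_line_restr; apply: meval_eq => l.
    by case: eqP => _; rewrite ?mulr1 ?add0r ?mulr0 ?addr0.
  have [i|c Hc] := cnr p.
    apply: contraNneq (Hv i).2 => pi0; apply/eqP.
    have -> : (G i).@[v i] = (p i).[v i jo].
      by rewrite pE; apply: meval_eq => l; case: eqP => [->|].
    by rewrite pi0 horner0.
  exists (fun l => if l == jo then c else a l) => i.
  exists (fun l => if l == jo then c else v i l); last by rewrite -pE.
  move=> l; rewrite ltnS leq_eqVlt; case: (l =P jo) => [//|ne] /orP[/eqP E|lj].
    by case: ne; apply/val_inj.
  exact: (Hv i).1.
have [a Ha] := H n; exists a => i; have [v va] := Ha i.
by rewrite (meval_eq _ (v2 := a)) // => l; apply: va.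
Qed.

(** * Order of vanishing through Taylor expansions *)

Definition shift (k : fieldType) (n : nat) (v : 'I_n -> k) (F : {mpoly k[n]}) :
    {mpoly k[n]} :=
  mmap (@mpolyC n k) (fun i => 'X_i + (v i)%:MP) F.

(** Multiplicity at least [m] on affine space. Through Taylor coefficients the condition is linear
    in [F] and polynomial in [v], which later gives openness. *)
Definition vanishes (k : fieldType) (n m : nat) (v : 'I_n -> k)
    (F : {mpoly k[n]}) : Prop :=
  forall u, (mdeg u < m)%N -> (shift v F)@_u = 0.

Section Vanishing.
Variables (k : fieldType) (n : nat).
Implicit Types (F G : {mpoly k[n]}) (v w : 'I_n -> k).

Lemma shiftM v F G : shift v (F * G) = shift v F * shift v G.
Proof. exact: rmorphM. Qed.

Lemma mmap_shift (A : comNzRingType) (f : {rmorphism k -> A}) (h : 'I_n -> A) v F :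
  mmap f h (shift v F) = mmap f (fun i => h i + f (v i)) F.
Proof.
rewrite /shift rmorph_mmap; apply: eq_mmap => [c|i] /=; first by rewrite mmapC.
by rewrite rmorphD /= mmapC mmapX mmap1U.
Qed.

Lemma coef0_shift v F : (shift v F)@_0 = F.@[v].
Proof.
have E (P : {mpoly k[n]}) : P@_0 = P.@[fun=> 0].
  rewrite mevalE [in LHS](mpolyE P) raddf_sum /=; apply: eq_bigr => m _.
  rewrite mcoeffZ mcoeffX; congr (_ * _); have [->|m0] := eqVneq.
    by rewrite big1 // => i _; rewrite mnm0E.
  have [i mi] : exists i, m i != 0%N.
    apply/existsP; apply: contraR m0; rewrite negb_exists => /forallP H.
    by apply/eqP/mnmP => i; rewrite mnm0E; have := H i; rewrite negbK => /eqP.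
  by rewrite (bigD1 i) //= expr0n (negbTE mi) mul0r.
rewrite E [LHS]mmap_shift; apply: eq_mmap => // i.
by rewrite add0r.
Qed.

Lemma vanishes0 v F : vanishes 0 v F.
Proof. by []. Qed.

Lemma vanishes1 v F : F.@[v] = 0 -> vanishes 1 v F.
Proof.
by move=> Fv u; rewrite ltnS leqn0 mdeg_eq0 => /eqP ->; rewrite coef0_shift.
Qed.

Lemma vanishesD m v F G : vanishes m v F -> vanishes m v G -> vanishes m v (F + G).
Proof. by move=> vF vG u um; rewrite [shift v _]rmorphD mcoeffD /= vF ?vG ?addr0. Qed.

Lemma vanishesM m m' v F G :
  vanishes m v F -> vanishes m' v G -> vanishes (m + m') v (F * G).
Proof.
move=> vF vG u um; rewrite shiftM mcoeffM big1 // => -[u1 u2] /= /eqP E.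
have [u1m|mu1] := ltnP (mdeg u1) m; first by rewrite vF ?mul0r.
rewrite vG ?mulr0 // -(ltn_add2l m); apply: leq_ltn_trans um.
by rewrite [mdeg u in leqRHS](congr1 mdeg E) mdegD leq_add2r.
Qed.

Lemma vanishes_prod (I : Type) (s : seq I) (m : I -> nat) v
    (F : I -> {mpoly k[n]}) : (forall i, vanishes (m i) v (F i)) ->
  vanishes (\sum_(i <- s) m i) v (\prod_(i <- s) F i).
Proof.
by move=> H; elim/big_rec2: _ => [|i G j _ vG]; [apply: vanishes0|apply: vanishesM].
Qed.

Lemma vanishes_sum (I : eqType) (s : seq I) m v (F : I -> {mpoly k[n]}) :
  (forall i, i \in s -> vanishes m v (F i)) -> vanishes m v (\sum_(i <- s) F i).
Proof.
move=> H; rewrite big_seq; elim/big_rec: _ => [|i G si vG].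
  by move=> u _; rewrite [shift v 0]rmorph0 mcoeff0.
by apply: vanishesD => //; apply: H.
Qed.

(** The Taylor coefficient of the product at [u] is [G.@[v]] times that of [F] plus terms with lower
    coefficients of [F], which vanish by induction on the degree. *)
Lemma vanishes_cancel m v F G : G.@[v] != 0 -> vanishes m v (G * F) -> vanishes m v F.
Proof.
move=> Gv vGF u; have [d] := ubnP (mdeg u); elim: d u => // d IH u ud um.
have := vGF u um; rewrite shiftM mcoeffM.
have u0 : (mdeg (0%MM : 'X_{1..n}) < (mdeg u).+1)%N by rewrite mdeg0.
rewrite (bigD1 (BMultinom u0, BMultinom (ltnSn (mdeg u)))) /=; last by rewrite add0m.
rewrite big1 ?addr0 => [/eqP|[u1 u2] /= /andP[/eqP E ne]].
  by rewrite coef0_shift mulf_eq0 (negbTE Gv) => /eqP.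
have u1_gt0 : (0 < mdeg u1)%N.
  rewrite lt0n mdeg_eq0; apply: contraNneq ne => u10.
  have u2u : bmnm u2 = u by rewrite [RHS]E u10 add0m.
  by apply/eqP; congr (_, _); apply: val_inj.
have lt : (mdeg u2 < mdeg u)%N.
  by rewrite [mdeg u in ltnRHS](congr1 mdeg E) mdegD -[ltnLHS]add0n ltn_add2r.
by rewrite IH ?mulr0 //; [apply: leq_trans lt _|apply: ltn_trans um].
Qed.

Lemma mmap_scale (A : comNzRingType) (f : k -> A) d (z : A) (h : 'I_n -> A) F :
  F \is d.-homog -> mmap f (fun i => z * h i) F = z ^+ d * mmap f h F.
Proof.
move=> /dhomogP Fd; rewrite /mmap mulr_sumr big_seq [RHS]big_seq.
apply: eq_bigr => u /Fd <-; rewrite mulrCA; congr (_ * _).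
rewrite /= mdegE /mmap1 -prodrXr -big_split /=; apply: eq_bigr => i _.
by rewrite exprMn.
Qed.

(** Substituting [c * X_i] for [X_i] in the expansion at [c * v] gives [c ^+ d] times the expansion
    at [v], and it multiplies the coefficient of [u] by [c ^+ mdeg u]. *)
Lemma vanishes_scale d m v c F : F \is d.-homog -> c != 0 ->
  vanishes m v F -> vanishes m (fun i => c * v i) F.
Proof.
move=> Fd c0 vF u um.
have E : mmap (@mpolyC n k) (fun i => c%:MP * 'X_i) (shift (fun i => c * v i) F) =
         (c ^+ d) *: shift v F.
  rewrite mmap_shift -mul_mpolyC rmorphXn -(mmap_scale _ _ _ Fd).
  by apply: eq_mmap => // i; rewrite mulrDr /= mpolyCM.
have coefE (P : {mpoly k[n]}) :
    (mmap (@mpolyC n k) (fun i => c%:MP * 'X_i) P)@_u = c ^+ mdeg u * P@_u.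
  rewrite /mmap raddf_sum [in RHS](mpolyE P) raddf_sum mulr_sumr /=.
  apply: eq_bigr => w _; rewrite mcoeffCM mcoeffZ mcoeffX mulrCA; congr (_ * _).
  have -> : mmap1 (fun i => c%:MP * 'X_i) w = (c ^+ mdeg w) *: 'X_[w].
    rewrite -mul_mpolyC rmorphXn mdegE -prodrXr mpolyXE_id -big_split /=.
    by apply: eq_bigr => i _; rewrite exprMn.
  by rewrite mcoeffZ mcoeffX; have [->|] := eqVneq; rewrite ?mulr0.
have /eqP := coefE (shift (fun i => c * v i) F).
rewrite E mcoeffZ vF // mulr0 eq_sym mulf_eq0 expf_eq0 (negbTE c0) andbF.
by move/eqP.
Qed.

(** Every monomial of the expansion has degree at least [m] and so contributes a multiple of
    [z ^+ m]. A general ring [A] covers both lines and the two-parameter families used for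
    hyperplanes. *)
Lemma vanishes_taylor (A : comNzRingType) (f : {rmorphism k -> A}) m v
    (w : 'I_n -> A) (z : A) F : vanishes m v F ->
  exists Q, mmap f (fun i => f (v i) + z * w i) F = z ^+ m * Q.
Proof.
move=> vF.
have -> : mmap f (fun i => f (v i) + z * w i) F = mmap f (fun i => z * w i) (shift v F).
  by rewrite mmap_shift; apply: eq_mmap => // i; rewrite addrC.
exists (\sum_(u <- msupp (shift v F)) f (shift v F)@_u * (z ^+ (mdeg u - m) * mmap1 w u)).
rewrite /mmap mulr_sumr; apply: eq_big_seq => u uF.
have mu : (m <= mdeg u)%N.
  by rewrite leqNgt; apply/negP => /vF/eqP; rewrite mcoeff_eq0 uF.
rewrite mulrCA; congr (_ * _); rewrite mulrA -exprD subnKC // mdegE.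
by rewrite /mmap1 -prodrXr -big_split /=; apply: eq_bigr => i _; rewrite exprMn.
Qed.

Lemma coef_line_restr v w F l :
  (line_restr F v w)`_l = (pihomog mdeg l (shift v F)).@[w].
Proof.
have -> : line_restr F v w = mmap polyC (fun i => w i *: 'X) (shift v F).
  by rewrite mmap_shift; apply: eq_mmap => // i; rewrite addrC.
rewrite /mmap coef_sum pihomogE raddf_sum [RHS]big_mkcond /=; apply: eq_bigr => u _.
rewrite coefCM; have -> : mmap1 (fun i => w i *: 'X) u =
    (\prod_i w i ^+ u i) *: 'X^(mdeg u) :> {poly k}.
  rewrite -mul_polyC rmorph_prod mdegE -prodrXr -big_split /=.
  by apply: eq_bigr => i _; rewrite -mul_polyC exprMn rmorphXn.
rewrite coefZ coefXn eq_sym; case: eqP => _; rewrite ?mulr1 ?mulr0 //.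
by rewrite mevalZ mevalX.
Qed.

Lemma size_line_restr d v w F : F \is d.-homog -> (size (line_restr F v w) <= d.+1)%N.
Proof.
move=> /dhomogP Fd; rewrite /line_restr /mmap.
rewrite big_seq; apply: (leq_trans (size_sum _ _ _)); apply/bigmax_leqP_seq => u _ /Fd <-.
rewrite mul_polyC; apply: leq_trans (size_scale_leq _ _) _; rewrite /= mdegE /mmap1.
elim/big_rec2: _ => [|i P d' _ IH]; first by rewrite size_poly1.
apply: leq_trans (size_polyMleq _ _) _.
have s2 : (size ((v i)%:P + w i *: 'X)%R <= 2)%N.
  apply: leq_trans (size_polyD _ _) _; rewrite geq_max.
  rewrite (leq_trans (size_polyC_leq1 _)) //=.
  by rewrite (leq_trans (size_scale_leq _ _)) // size_polyX.
have s3 : (size (((v i)%:P + w i *: 'X) ^+ u i)%R <= (u i).+1)%N.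
  apply: leq_trans (size_poly_exp_leq _ _) _; rewrite ltnS -[leqRHS]mul1n leq_mul2r.
  by apply/orP; right; lia.
by rewrite -subn1 leq_subLR (leq_trans (leq_add s3 IH)) // addSn addnS add1n.
Qed.

Lemma vanishes_dvd_line m v w F : vanishes m v F ->
  exists Q, line_restr F v w = 'X^m * Q.
Proof.
move=> /(vanishes_taylor polyC (fun i => (w i)%:P) 'X)[Q E]; exists Q.
by rewrite -E; apply: eq_mmap => // i; rewrite mulrC mul_polyC.
Qed.

Hypothesis char0 : [pchar k] =i pred0.

(** A nonzero homogeneous component of the Taylor expansion is nonzero at some direction [w], and
    its value there is a coefficient of the restriction to that line. *)
Lemma vanishes_of_line m v F :
  (forall w, exists Q, line_restr F v w = 'X^m * Q) -> vanishes m v F.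
Proof.
move=> H u um; apply/eqP/negPn/negP => Fu.
pose P := pihomog mdeg (mdeg u) (shift v F).
have /(mpoly_nonvanishing char0)[w] : P != 0.
  apply: contraNneq Fu => P0; apply/eqP; rewrite -[RHS](mcoeff0 k u) -P0.
  rewrite /P pihomogE [in LHS](mpolyE (shift v F)) !raddf_sum /= [RHS]big_mkcond.
  apply: eq_bigr => u' _; case: eqP => // ne; rewrite mcoeffZ mcoeffX.
  by case: eqP => [u'u|]; rewrite ?mulr0 //; case: ne; rewrite u'u.
rewrite /P -coef_line_restr; have [Q ->] := H w.
by rewrite coefXnM um eqxx.
Qed.

(** On the line from [v] to a vector where [F] is nonzero, [F] restricts to a nonzero polynomial of
    degree at most [d] divisible by ['X^m]. *)
Lemma vanishes_le_deg d m v F : F != 0 -> F \is d.-homog -> vanishes m v F -> (m <= d)%N.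
Proof.
move=> F0 Fd vF; have [w Fw] := mpoly_nonvanishing char0 F0.
have [Q E] := vanishes_dvd_line (fun i => w i - v i) vF.
have l0 : line_restr F v (fun i => w i - v i) != 0.
  apply: contraNneq Fw => l0; have := horner_line_restr F v (fun i => w i - v i) 1.
  rewrite l0 horner0 => /esym E1; apply/eqP; rewrite -E1; apply: meval_eq => i.
  by rewrite mul1r subrKC.
have Q0 : Q != 0 by apply: contraNneq l0 => Q0; rewrite E Q0 mulr0.
have := size_line_restr v (fun i => w i - v i) Fd.
rewrite E size_proper_mul ?size_polyXn; last first.
  by rewrite lead_coefXn mul1r lead_coef_eq0.
by move: Q0; rewrite -size_poly_gt0; case: (size Q) => //= s _; rewrite addnS; lia.
Qed.

End Vanishing.

(** * Restriction of forms to hyperplanes *)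

(* If [w] lists the coefficients of a polynomial [W], then [hyp_coord c t w]
   lists those of [('X - c) * W + t]. *)
Definition hyp_coord (A : comNzRingType) (n : nat) (c t : A) (w : 'I_n -> A)
    (j : 'I_n.+1) : A :=
  (if unlift ord0 j is Some i then w i else t)
  - c * (if unlift ord_max j is Some i then w i else 0).

Lemma hyp_coordE (A : comNzRingType) (n : nat) (c t : A) (W : {poly A}) (j : 'I_n.+1) :
  (size W <= n)%N ->
  hyp_coord c t (fun i : 'I_n => W`_i) j = (('X - c%:P) * W + t%:P)`_j.
Proof.
move=> sW; rewrite /hyp_coord mulrBl coefD coefB coefXM coefCM coefC.
have -> : (if unlift ord_max j is Some i then W`_i else 0) = W`_j.
  case: (unliftP ord_max j) => [i|] -> /=; last by rewrite nth_default.
  by rewrite /bump leqNgt ltn_ord.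
case: (unliftP ord0 j) => [i|] -> /=; last by rewrite add0r addrC.
by rewrite addr0.
Qed.

Lemma rmorph_hyp_coord (A B : comNzRingType) (phi : {rmorphism A -> B}) (n : nat)
    (c t : A) (w : 'I_n -> A) (j : 'I_n.+1) :
  phi (hyp_coord c t w j) = hyp_coord (phi c) (phi t) (phi \o w) j.
Proof.
rewrite /hyp_coord rmorphB rmorphM; congr (_ - _ * _).
  by case: unlift.
by case: unlift => //=; rewrite rmorph0.
Qed.

Lemma eq_hyp_coord (A : comNzRingType) (n : nat) (c c' t t' : A) (w w' : 'I_n -> A) j :
  c = c' -> t = t' -> w =1 w' -> hyp_coord c t w j = hyp_coord c' t' w' j.
Proof.
by move=> <- <- ww; rewrite /hyp_coord; case: unlift => [i|]; case: unlift => [i'|];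
  rewrite ?ww.
Qed.

Lemma hyp_coordD (A : comNzRingType) (n : nat) (c t t' z : A) (w w' : 'I_n -> A) j :
  hyp_coord c t w j + z * hyp_coord c t' w' j =
  hyp_coord c (t + z * t') (fun i => w i + z * w' i) j.
Proof.
rewrite /hyp_coord; case: unlift => [i|]; case: unlift => [i'|];
  by rewrite ?mulr0 ?subr0 // mulrBr mulrDr addrACA -opprD mulrCA.
Qed.

Section Restriction.
Variables (k : fieldType) (n : nat).
Implicit Types (F : {mpoly k[n.+1]}).

(** [F] in the linear coordinates [(t, w)], as a polynomial in [t]: the order along the hyperplane
    [t = 0] is the least index of a nonzero coefficient, and that coefficient is the residual form
    restricted to the hyperplane. *)
Definition hyp_expand (c : k) F : {poly {mpoly k[n]}} :=
  mmap (polyC \o @mpolyC n k) (hyp_coord (c%:MP)%:P 'X (fun i => ('X_i)%:P)) F.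

Lemma horner_hyp_expand (A : comNzRingType) (f : {rmorphism k -> A}) (w : 'I_n -> A)
    (t : A) (c : k) F :
  (map_poly (mmap f w) (hyp_expand c F)).[t] = mmap f (hyp_coord (f c) t w) F.
Proof.
rewrite -[LHS]/((horner_eval t \o map_poly (mmap f w)) _) rmorph_mmap.
apply: eq_mmap => [x|j] /=.
  by rewrite map_polyC /horner_eval hornerC /= mmapC.
rewrite !rmorph_hyp_coord; apply: eq_hyp_coord => [||i] /=; rewrite /horner_eval.
- by rewrite map_polyC hornerC /= mmapC.
- by rewrite map_polyX hornerX.
- by rewrite map_polyC hornerC /= mmapX mmap1U.
Qed.

(** Read [v] as a polynomial and divide by ['X - c%:P]: the quotient gives [w], the remainder is the
    value at [c]. *)
Lemma hyp_coord_surj (c : k) (v : 'I_n.+1 -> k) :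
  exists w, v =1 hyp_coord c (\sum_j v j * c ^+ j) w.
Proof.
have -> : \sum_j v j * c ^+ j = (\poly_(j < n.+1) v (inord j)).[c].
  by rewrite horner_poly; apply: eq_bigr => j _; rewrite inord_val.
pose P := \poly_(j < n.+1) v (inord j).
have /factor_theorem[W E] : root (P - P.[c]%:P) c.
  by rewrite /root !hornerE subrr.
have sW : (size W <= n)%N.
  have [->|W0] := eqVneq W 0; first by rewrite size_poly0.
  have := size_poly n.+1 (fun j => v (inord j)).
  rewrite -/P -(subrK P.[c]%:P P) E size_polyDl size_Mmonic ?monicXsubC // size_XsubC.
    by rewrite addn2.
  rewrite addn2 /= (leq_ltn_trans (size_polyC_leq1 _)) // ltnS size_poly_gt0 //.
exists (fun i => W`_i) => j; rewrite (hyp_coordE _ _ _ sW) mulrC -E subrK coef_poly.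
by rewrite ltn_ord inord_val.
Qed.

Lemma hyp_expand_eq0 (c : k) F : [pchar k] =i pred0 -> F != 0 -> hyp_expand c F != 0.
Proof.
move=> char0 /(mpoly_nonvanishing char0)[v Fv]; apply: contraNneq Fv => E.
have [w vw] := hyp_coord_surj c v; rewrite (meval_eq _ vw).
by rewrite -[_.@[_]](horner_hyp_expand idfun) E map_poly0 horner0.
Qed.

Lemma hyp_expand_homog (c : k) d F e : F \is d.-homog -> (e <= d)%N ->
  (hyp_expand c F)`_e \is (d - e).-homog.
Proof.
(* Homogeneity of degree [D] in [t] and the other variables jointly. It is additive in [D] under
   products, and the substituted coordinates satisfy it with [D = 1]. *)
pose bih D (Q : {poly {mpoly k[n]}}) := forall i u, Q`_i@_u != 0 -> (mdeg u + i)%N = D.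
have bihM D D' Q Q' : bih D Q -> bih D' Q' -> bih (D + D')%N (Q * Q').
  move=> bQ bQ' i u; rewrite coefM raddf_sum /= => nz.
  have /existsP[j nz1] : [exists j : 'I_i.+1, (Q`_j * Q'`_(i - j))@_u != 0].
    apply: contraR nz; rewrite negb_exists => /forallP H.
    by apply/eqP/big1 => j _; apply/eqP; have := H j; rewrite negbK.
  have : u \in msupp (Q`_j * Q'`_(i - j)) by rewrite mcoeff_msupp.
  case/msuppM_le/allpairsP => -[u1 u2] /= [].
  rewrite !mcoeff_msupp => /bQ <- /bQ' <- ->.
  by rewrite mdegD; have := ltn_ord j; lia.
have bihD D Q Q' : bih D Q -> bih D Q' -> bih D (Q + Q').
  move=> bQ bQ' i u; rewrite coefD mcoeffD.
  have [->|/bQ //] := eqVneq (Q`_i@_u) 0; rewrite add0r; exact: bQ'.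
have bihC x : bih 0 (x%:MP)%:P.
  move=> i u; rewrite coefC; have [->|_] := eqVneq i 0%N; last by rewrite mcoeff0 eqxx.
  rewrite mcoeffC; have [->|_] := eqVneq u 0%MM; first by rewrite mdeg0.
  by rewrite mulr0 eqxx.
have bihX i : bih 1 ('X_i)%:P.
  move=> j u; rewrite coefC; have [->|_] := eqVneq j 0%N; last by rewrite mcoeff0 eqxx.
  by rewrite mcoeffX; have [<-|_] := eqVneq U_(i)%MM u; rewrite ?mdeg1 ?eqxx.
have bihT : bih 1 'X.
  move=> j u; rewrite coefX; have [->|_] := eqVneq j 1%N; last by rewrite mcoeff0 eqxx.
  by rewrite mcoeff1; have [->|_] := eqVneq u 0%MM; rewrite ?mdeg0 ?eqxx.
have bih0 D : bih D 0 by move=> j u; rewrite coef0 mcoeff0 eqxx.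
have bih1 : bih 0 1 by exact: (bihC 1).
have bihXn D j Q : bih D Q -> bih (D * j)%N (Q ^+ j).
  move=> bQ; elim: j => [|j IH]; first by rewrite muln0.
  by rewrite exprS mulnS; apply: bihM.
have bihH j : bih 1 (hyp_coord (c%:MP)%:P 'X (fun i => ('X_i)%:P) j).
  rewrite /hyp_coord -mulNr -polyCN -mpolyCN; apply: bihD.
    by case: unlift => [i|]; [exact: bihX|exact: bihT].
  apply: (bihM 0%N 1%N); first exact: bihC.
  by case: unlift => [i|]; [exact: bihX|exact: bih0].
move=> /dhomogP Fd ed; suff bF : bih d (hyp_expand c F).
  apply/dhomogP => u; rewrite mcoeff_msupp => /bF <-.
  by rewrite addnK.
rewrite /hyp_expand /mmap big_seq; elim/big_ind: _; [exact: bih0|exact: bihD|].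
move=> u /Fd <-; apply: (bihM 0%N (mdeg u)); first exact: bihC.
rewrite mdegE /mmap1; elim/big_rec2: _ => [|j Q d' _ bQ]; first exact: bih1.
by apply: bihM => //; have := bihXn 1%N (u j) _ (bihH j); rewrite mul1n.
Qed.

Lemma hyp_expand_vanishes (c : k) m e (p : 'I_n -> k) F : [pchar k] =i pred0 ->
  vanishes m (hyp_coord c 0 p) F -> vanishes (m - e) p (hyp_expand c F)`_e.
Proof.
move=> char0 vF; have [|em] := leqP m e.
  by rewrite -subn_eq0 => /eqP ->; apply: vanishes0.
apply: vanishes_of_line => // w.
(* Two parameters: the inner variable [z] moves along the line, the outer ['X] scales [t]. The value
   of [F] at [t = z * 'X] over [p + z * w] is divisible by [z ^+ m], and its coefficient of ['X^e]
   is [z ^+ e] times the restricted [e]-th coefficient; cancelling [z ^+ e] leaves order [m - e]. *)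
pose f : {rmorphism k -> {poly {poly k}}} := polyC \o polyC.
pose z : {poly {poly k}} := 'X%:P.
have [Q E] := vanishes_taylor f (hyp_coord (f c) 'X (f \o w)) z vF.
pose h i := f (p i) + z * f (w i).
have E2 : (map_poly (mmap f h) (hyp_expand c F)).[z * 'X] = z ^+ m * Q.
  rewrite -E horner_hyp_expand; apply: eq_mmap => // j.
  rewrite rmorph_hyp_coord hyp_coordD rmorph0 add0r.
  exact: eq_hyp_coord.
have hE (G : {mpoly k[n]}) : mmap f h G = (line_restr G p w)%:P.
  rewrite /line_restr rmorph_mmap; apply: eq_mmap => // i /=.
  by rewrite /h /f /z /= -polyCM -polyCD mulrC mul_polyC.
have := congr1 (fun P : {poly {poly k}} => P`_e) E2.
rewrite -rmorphXn /= coefCM.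
have -> : ((map_poly (mmap f h) (hyp_expand c F)).[z * 'X])`_e =
          'X^e * line_restr (hyp_expand c F)`_e p w.
  set q := map_poly _ _; rewrite (horner_coef_wide _ (leq_maxl (size q) e.+1)) coef_sum.
  rewrite (bigD1 (Ordinal (leq_maxr (size q) e.+1))) //= big1 ?addr0 => [|i ie].
    by rewrite coef_map /= hE exprMn mulrA coefMXn ltnn subnn -rmorphXn -polyCM coefC mulrC.
  rewrite coef_map /= hE exprMn mulrA coefMXn -rmorphXn -polyCM coefC.
  case: ltnP => // ie2; rewrite subn_eq0 leqNgt ltn_neqAle ie2 andbT.
  by rewrite (_ : _ == _ = false) //; apply: contraNF ie => /eqP ie; apply/eqP/val_inj.
move=> E3; exists Q`_e; apply: (mulfI (x := 'X^e)); first by rewrite -size_poly_gt0 size_polyXn.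
by rewrite E3 mulrA -exprD subnKC // ltnW.
Qed.

End Restriction.

Lemma hyp_coord_addt (A : comNzRingType) (n : nat) (c t t' : A) (w : 'I_n -> A) j :
  hyp_coord c (t + t') w j = hyp_coord c t w j + (j == ord0)%:R * t'.
Proof.
rewrite /hyp_coord; case: (unliftP ord0 j) => [i|] ->.
  by rewrite eq_sym (negbTE (neq_lift _ _)) mul0r addr0.
by rewrite eqxx mul1r addrAC.
Qed.

(** Adding a constant to [v], read as a polynomial, shifts its value [t] at [c] and keeps the
    quotient [w]. So in direction [ord0] the factor [t ^+ e] becomes the power of a linear
    factor. *)
Lemma hyp_expand_line (k : fieldType) (n : nat) (c : k) (F : {mpoly k[n.+1]})
    (v : 'I_n.+1 -> k) e Q :
  hyp_expand c F = 'X^e * Q ->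
  ('X - (- \sum_j v j * c ^+ j)%:P) ^+ e %|
  line_restr F v (fun j => (j == ord0)%:R).
Proof.
move=> E; have [w] := hyp_coord_surj c v; set r := \sum_j _ => vw.
have -> : line_restr F v (fun j => (j == ord0)%:R) =
    mmap polyC (hyp_coord c%:P ('X - (- r)%:P) (fun i => (w i)%:P)) F.
  apply: eq_mmap => // j; rewrite vw polyCN opprK ['X + _]addrC hyp_coord_addt.
  congr (_ + _); first exact: (rmorph_hyp_coord polyC).
  by rewrite -mul_polyC; case: eqP => _; rewrite ?mul1r ?mul0r.
rewrite -horner_hyp_expand E rmorphM /= map_polyXn hornerM hornerXn.
exact: dvdp_mulIl.
Qed.

Lemma prod_dvdp (k : fieldType) (I : eqType) (s : seq I) (p : I -> {poly k}) (f : {poly k}) :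
  uniq s -> {in s &, forall i j, i != j -> coprimep (p i) (p j)} ->
  {in s, forall i, p i %| f} -> \prod_(i <- s) p i %| f.
Proof.
elim: s => [|x s IH] /= => [_ _ _|/andP[xs us] cop dv].
  by rewrite big_nil dvd1p.
rewrite big_cons Gauss_dvdp ?dv ?mem_head //=.
  apply: IH => // [i j si sj|i si]; last by rewrite dv // inE si orbT.
  by apply: cop; rewrite inE ?si ?sj orbT.
rewrite big_seq; elim/big_rec: _ => [|i q si cq]; first exact: coprimep1.
rewrite coprimepMr cq cop ?mem_head ?inE ?si ?orbT //.
by apply: contraNneq xs => ->.
Qed.

(** On a suitable line in direction [ord0], distinct hyperplanes contribute coprime factors to the
    restriction of [F], whose degree is at most [d]. *)
Lemma sum_hyp_order (k : fieldType) (n d : nat) (I : finType) (a : I -> k)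
    (B : {set I}) (e : I -> nat) (F : {mpoly k[n.+2]}) :
  [pchar k] =i pred0 -> injective a -> F != 0 -> F \is d.-homog ->
  {in B, forall i, exists Q, hyp_expand (a i) F = 'X^(e i) * Q} ->
  (\sum_(i in B) e i <= d)%N.
Proof.
move=> char0 ainj F0 Fd HB; have [x Fx] := mpoly_nonvanishing char0 F0.
pose r (v : 'I_n.+2 -> k) c := \sum_j v j * c ^+ j.
pose j1 : 'I_n.+2 := lift ord0 ord0.
(* Moving along coordinate 1 changes the value at [c] by [t * c], which separates the values at
   distinct [a i] for general [t]. *)
pose u t j := x j + t * (j == j1)%:R.
have ru t c : r (u t) c = r x c + t * c.
  rewrite /r /u (bigD1 j1) // [in RHS](bigD1 j1) // eqxx mulr1 mulrDl expr1.
  rewrite addrAC; congr (_ + _ + _); apply: eq_bigr => j /negbTE ->.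
  by rewrite mulr0 addr0.
(* The pairs ask for distinct values at the [a i], the index [None] for [F] to be nonzero at
   [u t]. *)
pose p (o : option (I * I)) : {poly k} := if o is Some (i, j) then
    if i == j then 1 else (r x (a i) - r x (a j))%:P + (a i - a j)%:P * 'X
  else line_restr F x (fun j => (j == j1)%:R).
have [[[i j]|]|t Ht] := common_nonroots_fin (T := option (I * I)) char0 (p := p).
- rewrite /p; case: (eqVneq i j) => [_|ij]; first exact: oner_neq0.
  have := ij; rewrite -(inj_eq ainj) -subr_eq0; apply: contraNneq.
  by move=> /(congr1 (fun P : {poly k} => P`_1)); rewrite coefD coefC coefCM coefX coef0 mulr1 add0r => ->.
- apply: contraNneq Fx => /= l0; have := horner_line_restr F x (fun j => (j == j1)%:R) 0.
  rewrite l0 horner0 => /esym E1; apply/eqP; rewrite -E1; apply: meval_eq => i.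
  by rewrite mul0r addr0.
pose v := u t.
have rv : {in B &, forall i j, i != j -> r v (a i) != r v (a j)}.
  move=> i j _ _ ij; have := Ht (Some (i, j)); rewrite /= (negbTE ij) !hornerE.
  apply: contraNneq; rewrite /v !ru => E0; apply/eqP.
  by rewrite [_ * t]mulrC mulrBr addrACA -opprD E0 subrr.
pose f := line_restr F v (fun j => (j == ord0)%:R).
have f0 : f != 0.
  have := Ht None; rewrite /= horner_line_restr; apply: contraNneq => f0.
  have := horner_line_restr F v (fun j => (j == ord0)%:R) 0.
  rewrite -/f f0 horner0 => /esym E1; apply/eqP; rewrite -E1; apply: meval_eq => i.
  by rewrite mul0r addr0.
pose q i : {poly k} := ('X - (- r v (a i))%:P) ^+ e i.
have qf : \prod_(i <- enum B) q i %| f.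
  apply: prod_dvdp => [|i j|i]; rewrite ?enum_uniq ?mem_enum // => iB.
    move=> jB ij; apply/coprimep_expl/coprimep_expr/coprimep_XsubC2.
    by rewrite opprK addrC subr_eq0 rv.
  by have [Q /(hyp_expand_line v)] := HB i iB.
have := leq_trans (dvdp_leq f0 qf) (size_line_restr _ _ Fd).
rewrite big_enum /= size_prod => [|i _]; last by rewrite expf_neq0 // polyXsubC_eq0.
under eq_bigr do rewrite size_exp_XsubC -addn1.
by rewrite big_split /= sum1_card subSn ?leq_addl // addnK.
Qed.

(** * Multiplicities at star configurations *)

Lemma polyXn_factor (A : comNzRingType) (P : {poly A}) : P != 0 ->
  exists e Q, P = 'X^e * Q /\ P`_e != 0.
Proof.
move=> P0; have ex : exists e, P`_e != 0.
  by exists (size P).-1; rewrite -lead_coefE lead_coef_eq0.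
case: (ex_minnP ex) => e Pe mine; exists e, (drop_poly e P); split=> //.
rewrite -[LHS](poly_take_drop e) [take_poly _ _](_ : _ = 0) ?add0r 1?mulrC //.
apply/polyP => i; rewrite coef_take_poly coef0; case: ltnP => // ie.
by apply/eqP; apply: contraTT ie => /mine; rewrite -leqNgt.
Qed.

(* Reading coordinates as coefficients of polynomials, the hyperplanes of the
   star configuration are the multiples of ['X - (a j)%:P]. *)
Definition star_point (k : fieldType) (I : finType) (a : I -> k) (n : nat)
    (J : {set I}) : 'I_n -> k :=
  fun i => (\prod_(j in J) ('X - (a j)%:P))`_i.

(** The star points on the hyperplane of [i] form a star configuration of one dimension less, which
    drives the induction. *)
Lemma star_pointU1 (k : fieldType) (I : finType) (a : I -> k) (n : nat) (i : I)
    (J : {set I}) : i \notin J -> #|J| = n ->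
  star_point a (n:=n.+2) (i |: J) = hyp_coord (a i) 0 (star_point a (n:=n.+1) J).
Proof.
move=> iJ cJ; apply/funext => j; rewrite /star_point hyp_coordE.
  by rewrite addr0 big_setU1.
rewrite -big_enum size_prod_XsubC -cJ cardE //.
Qed.

(** With [e i] the order of [F] along the hyperplane of [i], the residual form of degree [d - e i]
    restricts to it and keeps order [m J - e i] at its star points. Summing the inductive bounds
    over [i] counts each [J] once per element, and [sum_hyp_order] absorbs the terms in [e i]. *)
Lemma star_inequality (k : fieldType) (I : finType) (a : I -> k) (n d : nat)
    (B : {set I}) (m : {set I} -> nat) (F : {mpoly k[n.+1]}) :
  [pchar k] =i pred0 -> injective a -> F != 0 -> F \is d.-homog ->
  (forall J : {set I}, J \subset B -> #|J| = n -> vanishes (m J) (star_point a J) F) ->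
  (\sum_(J : {set I} | (J \subset B) && (#|J| == n)) m J
     <= d * (if n is n'.+1 then 'C(#|B|.-1, n') else 0))%N.
Proof.
move=> char0 ainj; elim: n d B m F => [|n IHn] d B m F F0 Fd vF.
  (* In one variable the only star vector is 1, where a nonzero form does not vanish, so the
     prescribed order is 0. *)
  rewrite muln0 leqn0 sum_nat_eq0; apply/forallP => J; apply/implyP => /andP[JB].
  rewrite cards_eq0 => /eqP J0; have [v Fv] := mpoly_nonvanishing char0 F0.
  have := vF J JB; rewrite J0 cards0 => /(_ erefl); case: (m _) => // m' vm.
  have := vm 0%MM; rewrite mdeg0 coef0_shift => /(_ isT) F1.
  case/eqP: Fv; have -> : F.@[v] = v ord0 ^+ d * F.@[star_point a finset.set0].
    rewrite -[RHS](mmap_scale idfun (v ord0) (star_point a finset.set0) Fd).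
    apply: eq_mmap => // i; rewrite ord1 /star_point big_set0 coef1 mulr1 //.
  by rewrite F1 mulr0.
have [cB|cB] := ltnP #|B| n.+1.
  rewrite big_pred0 // => J; apply/negbTE; rewrite negb_and orbC.
  case: eqP => //= cJ; apply: contraL cB => /subset_leq_card.
  by rewrite cJ -leqNgt.
have /choice[e He] i : exists e, exists Q,
    hyp_expand (a i) F = 'X^e * Q /\ (hyp_expand (a i) F)`_e != 0.
  exact/polyXn_factor/hyp_expand_eq0.
have se : (\sum_(i in B) e i <= d)%N.
  by apply: (sum_hyp_order char0 ainj F0 Fd) => i _; have [Q []] := He i; exists Q.
(* [C] counts the sets [J] containing a given [i]; [c'] is the factor in the inductive bound for the
   other hyperplanes. *)
pose C := 'C(#|B|.-1, n); pose c' := if n is n'.+1 then 'C(#|B|.-2, n') else 0%N.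
pose P := [pred J : {set I} | (J \subset B) && (#|J| == n.+1)].
have sum_i i : i \in B ->
    (\sum_(J : {set I} | P J && (i \in J)) m J <= (d - e i) * c' + e i * C)%N.
  move=> iB; have ei : (e i <= d)%N.
    by apply: leq_trans se; rewrite (bigD1 i) //= leq_addr.
  have cBi : #|B :\ i| = #|B|.-1 by rewrite (cardsD1 i B) iB.
  rewrite (reindex_onto (fun J => i |: J) (fun J => J :\ i)) /=; last first.
    by move=> J /andP[_ iJ]; rewrite finset.setD1K.
  rewrite (eq_bigl (fun J : {set I} => (J \subset B :\ i) && (#|J| == n))); last first.
    move=> J; rewrite finset.setU11 andbT finset.subUset finset.sub1set iB /= finset.subsetD1.
    have [iJ|iJ] := boolP (i \in J).
      rewrite andbF (_ : (i |: J) :\ i == J = false) ?andbF //.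
      by apply/eqP => E; have := finset.setD11 i (i |: J); rewrite E iJ.
    by rewrite cardsU1 iJ finset.setU1K // eqxx !andbT add1n eqSS.
  pose m' (J : {set I}) := (m (i |: J) - e i)%N.
  have IH : (\sum_(J : {set I} | (J \subset B :\ i) && (#|J| == n)) m' J <= (d - e i) * c')%N.
    have [Q [_ Ge]] := He i.
    have := IHn (d - e i)%N (B :\ i) m' _ Ge (hyp_expand_homog _ Fd ei).
    rewrite cBi; apply => J; rewrite finset.subsetD1 => /andP[JB iJ] cJ.
    apply: hyp_expand_vanishes => //; rewrite -star_pointU1 //.
    by apply: vF; rewrite ?finset.subUset ?finset.sub1set ?iB // cardsU1 iJ cJ.
  apply: (@leq_trans (\sum_(J : {set I} | (J \subset B :\ i) && (#|J| == n)) (m' J + e i))).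
    by apply: leq_sum => J _; rewrite addnC -leq_subLR.
  rewrite big_split /= leq_add // sum_nat_const mulnC leq_mul2l.
  rewrite /C -cBi -cards_draws; apply/orP; right; apply/eq_leq/eq_card => J.
  by rewrite !inE.
have double : (n.+1 * \sum_(J : {set I} | P J) m J =
    \sum_(i in B) \sum_(J : {set I} | P J && (i \in J)) m J)%N.
  rewrite (exchange_big_dep (fun J => P J)) /=; last by move=> i J _ /andP[].
  rewrite big_distrr /=; apply: eq_bigr => J /andP[JB /eqP cJ].
  rewrite (eq_bigl (mem J)); first by rewrite sum_nat_const cJ.
  move=> i; rewrite /= JB cJ eqxx /= andbC.
  by case iJ: (i \in J) => //=; apply: (fintype.subsetP JB).
have c'C : (c' <= C)%N.
  rewrite /c' /C; case: n cB {IHn F F0 Fd vF He se C c' P sum_i double} => // n' cB.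
  by case: #|B| cB => [|[|s]] //= _; rewrite binS leq_addl.
(* This identity turns [#|B|.-1 * c' + C] into [n.+1 * C]. *)
have c'n : ((#|B|.-1) * c' = n * C)%N.
  by rewrite /c' /C; case: (n) => [|n']; rewrite ?muln0 // mul_bin_diag.
have : (n.+1 * \sum_(J : {set I} | P J) m J <= d * (n.+1 * C))%N.
  rewrite double; apply: leq_trans (leq_sum _ sum_i) _.
  apply: (@leq_trans (\sum_(i in B) (d * c' + e i * (C - c')))).
    apply: leq_sum => i iB; have ei : (e i <= d)%N.
      by apply: leq_trans se; rewrite (bigD1 i) //= leq_addr.
    by rewrite mulnBl mulnBr; have := leq_mul ei (leqnn c'); have := leq_mul (leqnn (e i)) c'C; lia.
  rewrite big_split /= sum_nat_const -big_distrl /=.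
  apply: (@leq_trans (#|B| * (d * c') + d * (C - c'))); first by rewrite leq_add2l leq_mul2r se orbT.
  rewrite mulSn -c'n; case: #|B| cB => [//|s _] /=.
  by rewrite mulnBr mulSn !mulnDr !mulnA [(s * d)%N]mulnC; have := leq_mul (leqnn d) c'C; lia.
by rewrite mulnCA leq_pmul2l.
Qed.

(** * Homogeneous coordinates of points *)

Section Points.
Variables (k : fieldType) (N : nat).

Definition hcoord (p : pspace k N) : 'I_N.+1 -> k := fun j => vpick (val p) 0 j.

Lemma vpick_point_neq0 (p : pspace k N) : vpick (val p) != 0.
Proof.
by case: p => L /= /eqP dL; rewrite vpick0; apply: contra_eqN dL => /eqP ->; rewrite dimv0.
Qed.

Lemma dim_vline1 (v : 'rV[k]_N.+1) : v != 0 -> \dim <[v]>%VS == 1%N.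
Proof. by move=> v0; rewrite dim_vline v0. Qed.

Lemma const1_neq0 : const_mx 1 != 0 :> 'rV[k]_N.+1.
Proof. by apply/eqP => /rowP/(_ 0)/eqP; rewrite !mxE oner_eq0. Qed.

(** The zero vector is sent to the default point, spanned by the all-ones vector. *)
Definition line_point (v : 'rV[k]_N.+1) : pspace k N :=
  insubd (exist (fun L : {vspace 'rV[k]_N.+1} => \dim L == 1%N) _
    (dim_vline1 const1_neq0)) <[v]>%VS.

Lemma hcoord_line_point (v : 'rV[k]_N.+1) : v != 0 ->
  exists2 c, c != 0 & forall j, hcoord (line_point v) j = c * v 0 j.
Proof.
move=> v0; have vE : val (line_point v) = <[v]>%VS by apply: insubdK; apply: dim_vline1.
have /vlineP[c cE] : vpick (val (line_point v)) \in <[v]>%VS by rewrite -vE memv_pick.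
exists c; last by move=> j; rewrite /hcoord cE mxE.
have := vpick_point_neq0 (line_point v); rewrite cE; apply: contraNneq => ->.
by rewrite scale0r.
Qed.

Lemma point_vline (p : pspace k N) : val p = <[vpick (val p)]>%VS.
Proof.
apply/eqP; rewrite eq_sym eqEdim -memvE memv_pick (eqP (valP p)) dim_vline.
by rewrite vpick_point_neq0.
Qed.

Lemma line_pointP (p : pspace k N) v : v \in val p -> exists c, v = c *: vpick (val p).
Proof.
move=> vp; have /vlineP[c cE] : v \in <[vpick (val p)]>%VS by rewrite -point_vline.
by exists c.
Qed.

Lemma proportional_points (p q : pspace k N) c :
  vpick (val p) = c *: vpick (val q) -> p = q.
Proof.
move=> pq; apply/val_inj/eqP; rewrite eqEdim (eqP (valP p)) (eqP (valP q)) leqnn andbT.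
by rewrite [X in (X <= _)%VS]point_vline -memvE pq memvZ // memv_pick.
Qed.
End Points.

(** * Zariski topology on tuples of points and on cycles *)

Section Multihomogeneous.
Variables (k : fieldType) (N n : nat).
Implicit Types (G : {mpoly k[(n * N.+1)%N]}) (x y : pspace_pow k N n).

Lemma big_mxvec (R : Type) (idx : R) (op : Monoid.com_law idx) (m p : nat)
    (F : 'I_(m * p)%N -> R) :
  \big[op/idx]_l F l = \big[op/idx]_i \big[op/idx]_j F (mxvec_index i j).
Proof.
rewrite pair_bigA (reindex (uncurry (@mxvec_index m p))) /=; last first.
  exact: curry_mxvec_bij.
by apply: eq_bigr => -[].
Qed.

Lemma meval_multihomog G (M M' : 'M[k]_(n, N.+1)) (c : 'I_n -> k) :
  multihomog G -> (forall i, c i != 0) -> (forall i j, M' i j = c i * M i j) ->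
  (G.@[mxvec M' 0] == 0) = (G.@[mxvec M 0] == 0).
Proof.
move=> [e Ge] c0 MM.
have -> : G.@[mxvec M' 0] = (\prod_i c i ^+ e i) * G.@[mxvec M 0].
  rewrite !mevalE mulr_sumr big_seq [RHS]big_seq; apply: eq_bigr => m mG.
  rewrite mulrCA; congr (_ * _); rewrite !big_mxvec -big_split /=.
  apply: eq_bigr => i _; rewrite -(Ge m mG) -prodrXr -big_split /=.
  by apply: eq_bigr => j _; rewrite !mxvecE MM exprMn.
rewrite mulf_eq0; case: eqVneq => // /eqP.
by rewrite prodf_seq_eq0 => /hasP[i _] /=; rewrite expf_eq0 (negbTE (c0 i)) andbF.
Qed.

Definition tuple_of_rows (M : 'M[k]_(n, N.+1)) : pspace_pow k N n :=
  [tuple line_point (row i M) | i < n].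

Lemma mheval_tuple_of_rows G (M : 'M[k]_(n, N.+1)) :
  multihomog G -> (forall i, row i M != 0) ->
  (mheval G (tuple_of_rows M) == 0) = (G.@[mxvec M 0] == 0).
Proof.
move=> mG M0; have /choice[c Hc] i : exists c, c != 0 /\
    forall j, hcoord (line_point (row i M)) j = c * M i j.
  have [c c0 cE] := hcoord_line_point (M0 i); exists c; split=> // j.
  by rewrite cE mxE.
apply: (meval_multihomog (c := c)) => // i; first exact: (Hc i).1.
by move=> j; rewrite mxE tnth_mktuple; exact: (Hc i).2.
Qed.

Lemma mhevalE G x : mheval G x = G.@[mxvec (\matrix_(i, j) hcoord (tnth x i) j) 0].
Proof.
by apply: meval_eq => l; case/mxvec_indexP: l => i j; rewrite !mxvecE !mxE.
Qed.

Lemma mheval_prod (I : Type) (s : seq I) (F : I -> {mpoly k[(n * N.+1)%N]}) x :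
  mheval (\prod_(i <- s) F i) x = \prod_(i <- s) mheval (F i) x.
Proof. exact: rmorph_prod. Qed.

Definition multideg (e : 'I_n -> nat) G : Prop :=
  forall m, G@_m != 0 -> forall i, (\sum_(j < N.+1) m (mxvec_index i j))%N = e i.

Lemma multideg_multihomog e G : multideg e G -> multihomog G.
Proof. by move=> eG; exists e => m; rewrite mcoeff_msupp; apply: eG. Qed.

Lemma multidegD e G H : multideg e G -> multideg e H -> multideg e (G + H).
Proof.
move=> eG eH m; rewrite mcoeffD.
by have [->|Gm _] := eqVneq (G@_m) 0; [rewrite add0r; apply: eH|apply: eG].
Qed.

Lemma multideg0 e : multideg e 0.
Proof. by move=> m; rewrite mcoeff0 eqxx. Qed.

Lemma multidegM e e' G H : multideg e G -> multideg e' H ->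
  multideg (fun i => e i + e' i)%N (G * H).
Proof.
move=> eG eH m; rewrite -mcoeff_msupp => /msuppM_le/allpairsP[[m1 m2]] /=.
rewrite !mcoeff_msupp => -[/eG e1 /eH e2 ->] i; rewrite -e1 -e2 -big_split /=.
by apply: eq_bigr => j _; rewrite mnmDE.
Qed.

Lemma multidegC c : multideg (fun=> 0%N) c%:MP.
Proof.
move=> m; rewrite mcoeffC; have [->|] := eqVneq m 0%MM; last by rewrite mulr0 eqxx.
by move=> _ i; rewrite big1 // => j _; rewrite mnm0E.
Qed.

Lemma multidegX (i : 'I_n) (j : 'I_N.+1) :
  multideg (fun i' => (i' == i) : nat) 'X_(mxvec_index i j).
Proof.
move=> m; rewrite mcoeffX; have [<- _ i'|_] := eqVneq U_(mxvec_index i j)%MM m; last by rewrite eqxx.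
have [g gK _] := curry_mxvec_bij n N.+1.
have inj : injective (uncurry (@mxvec_index n N.+1)) by apply: (can_inj (g := g)) => u; apply: gK.
under eq_bigr => j' _ do
  rewrite mnm1E (inj_eq inj (i, j) (i', j')) xpair_eqE.
rewrite [i' == i]eq_sym; case: (i == i') => /=; last by rewrite big1.
by rewrite (bigD1 j) //= eqxx big1 // => j'; rewrite eq_sym => /negbTE ->.
Qed.

Lemma multideg_sum (I : Type) (s : seq I) e (F : I -> {mpoly k[(n * N.+1)%N]}) :
  (forall i, multideg e (F i)) -> multideg e (\sum_(i <- s) F i).
Proof.
by move=> eF; elim/big_rec: _ => [|i G _]; [apply: multideg0|apply: multidegD].
Qed.

Lemma multideg_prod (I : Type) (s : seq I) (e : I -> 'I_n -> nat)
    (F : I -> {mpoly k[(n * N.+1)%N]}) : (forall i, multideg (e i) (F i)) ->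
  multideg (fun l => \sum_(i <- s) e i l)%N (\prod_(i <- s) F i).
Proof.
move=> eF; elim: s => [|i s IH].
  rewrite big_nil => m /multidegC H l; rewrite big_nil; exact: H.
rewrite big_cons => m /(multidegM (eF i) IH) H l; rewrite big_cons; exact: H.
Qed.

Lemma multihomog_prod (I : Type) (s : seq I) (F : I -> {mpoly k[(n * N.+1)%N]}) :
  (forall i, multihomog (F i)) -> multihomog (\prod_(i <- s) F i).
Proof.
move=> mF; elim/big_rec: _ => [|i G _ mG]; last exact: multihomogM.
apply: (multideg_multihomog (e := fun=> 0%N)); rewrite -(mpolyC1 _ k); exact: multidegC.
Qed.

(** For a two-element family this is the irreducibility of the product of projective spaces: two
    nonempty principal open sets meet. *)
Lemma common_point (T : Type) (i0 : T) (G : T -> {mpoly k[(n * N.+1)%N]}) :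
  [pchar k] =i pred0 -> common_nonroots k T -> (forall i, multihomog (G i)) ->
  (forall i, exists x, mheval (G i) x != 0) -> exists x, forall i, mheval (G i) x != 0.
Proof.
(* The factor [Y] forces every row of the common vector to be nonzero, so that the rows represent
   points. *)
move=> char0 cnr mG Gx; pose Y : {mpoly k[(n * N.+1)%N]} := \prod_(i < n) 'X_(mxvec_index i ord0).
have [|v Hv] := common_nonvanishing (G := fun i => G i * Y) cnr.
  move=> i; apply: mpoly_nonvanishing => //; apply: mulf_neq0.
    by have [x] := Gx i; apply: contraNneq => ->; rewrite /mheval meval0.
  apply/prodf_neq0 => j _; rewrite -msupp_eq0 msuppX //.
pose M : 'M[k]_(n, N.+1) := vec_mx (\row_l v l).
have MvE l : mxvec M 0 l = v l by rewrite vec_mxK mxE.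
have M0 i : row i M != 0.
  apply/eqP => /rowP/(_ ord0); rewrite !mxE => E.
  have := Hv i0; rewrite mevalM mulf_eq0 negb_or => /andP[_].
  by rewrite rmorph_prod (bigD1 i) //= mevalXU E mul0r eqxx.
exists (tuple_of_rows M) => i; rewrite mheval_tuple_of_rows //.
have := Hv i; rewrite mevalM mulf_eq0 negb_or => /andP[+ _].
by rewrite (meval_eq _ MvE).
Qed.

Lemma zariski_openP (U : set (pspace_pow k N n)) :
  (forall x, U x -> exists G, [/\ multihomog G, mheval G x != 0
     & forall y, mheval G y != 0 -> U y]) <-> open U.
Proof.
split=> [H|].
  exists [set G | multihomog G /\ forall y, mheval G y != 0 -> U y] => [G []//|].
  apply/seteqP; split=> x /=.
    by move=> nUx G [mG GU]; apply/eqP/negPn/negP => /GU.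
  move=> Hx /H[G [mG Gx GU]]; case/eqP: Gx; exact: Hx.
move=> [S Sh US] x Ux.
have /existsNP[G /not_implyP[SG /eqP Gx]] : ~ forall G, S G -> mheval G x = 0.
  by move=> Sx; have : (~` U) x by rewrite US.
exists G; split=> //; first exact: Sh.
move=> y Gy; apply: contrapT => nUy; have : (~` U) y by [].
by rewrite US => /(_ G SG)/eqP; rewrite (negbTE Gy).
Qed.

(** Written with [repr], this makes sense for every [V]; it is the image of [V] when [V] is
    symmetric. *)
Definition cycles (V : set (pspace_pow k N n)) : set (chow0 k N n) :=
  [set c | V (repr (c : {eq_quot (@same_cycle k N n)}))].

Definition symmetric_set (V : set (pspace_pow k N n)) : Prop :=
  forall x y, perm_eq x y -> V x -> V y.

Lemma cycles_cycle_of V (x : pspace_pow k N n) : symmetric_set V ->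
  cycles V (cycle_of x) <-> V x.
Proof.
move=> sV; have E : perm_eq (repr (\pi_({eq_quot (@same_cycle k N n)}) x)) x.
  have /eqmodP := reprK (\pi_({eq_quot (@same_cycle k N n)}) x); done.
split; apply: sV => //.
by rewrite perm_sym.
Qed.

Lemma open_cycles V : symmetric_set V -> open V -> open (cycles V).
Proof.
move=> sV oV; rewrite /open /= /quotient_open.
rewrite (_ : _ @^-1` _ = V) //; apply/seteqP; split=> x /= Hx.
  exact/(cycles_cycle_of _ sV).
exact/(cycles_cycle_of x sV).
Qed.

(** [V] and the preimage of a nonempty open set both contain nonempty principal open sets, which
    meet by [common_point]. *)
Lemma dense_cycles V : [pchar k] =i pred0 -> symmetric_set V -> open V -> V !=set0 ->
  dense (cycles V).
Proof.
move=> char0 sV /zariski_openP oV [x /oV[G [mG Gx GV]]] O [c Oc] oO.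
have /zariski_openP oO' : open (\pi_({eq_quot (@same_cycle k N n)}) @^-1` O) by [].
have [|H [mH Hc HO]] := oO' (repr (c : {eq_quot (@same_cycle k N n)})).
  by rewrite /= reprK.
have [||y Hy] := @common_point bool true (fun b => if b then G else H) char0
  (common_nonroots_fin char0).
- by case.
- by case; [exists x|eexists; exact: Hc].
exists (cycle_of y); split; first exact: (HO _ (Hy false)).
by apply/cycles_cycle_of => //; apply: GV (Hy true).
Qed.

End Multihomogeneous.

(** * Openness of the absence of forms with given multiplicities *)

Lemma dhomog_basis (k : fieldType) (N d : nat) :
  exists B : 'I_'C(d + N, d) -> {mpoly k[N.+1]},
  [/\ forall r, B r \is d.-homog,
      forall F, F \is d.-homog -> exists u : 'I_'C(d + N, d) -> k, F = \sum_r u r *: B r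
    & forall u : 'I_'C(d + N, d) -> k, \sum_r u r *: B r = 0 -> forall r, u r = 0].
Proof.
pose V := dhomog N.+1 k d; have <- : \dim {: V} = 'C(d + N, d) by rewrite dimvf.
exists (fun r => val (vbasis {: V})`_r); split=> [r|F Fd|u u0].
- exact: dhomog_is_dhomog.
- exists (fun r => coord (vbasis {: V}) r (DHomog Fd)).
  rewrite -[LHS]/(val (DHomog Fd)) [in LHS](coord_vbasis (memvf (DHomog Fd))).
  rewrite raddf_sum; exact: eq_bigr.
- have /freeP H := basis_free (vbasisP {: V}); apply: (H u); apply/val_inj.
  rewrite raddf_sum /= -[RHS]u0; exact: eq_bigr.
Qed.

Section Forms.
Variables (k : fieldType) (N n : nat).
Implicit Types (x y : pspace_pow k N n) (F : {mpoly k[N.+1]}).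
Local Notation M := (n * N.+1)%N.

Definition no_form (d : nat) (m : 'I_n -> nat) x : Prop :=
  forall F, F != 0 -> F \is d.-homog ->
  ~ forall i, vanishes (m i) (hcoord (tnth x i)) F.

(** Taylor expansion at the generic [i]-th point: the coefficients are polynomials in the
    coordinates of the [n] points. *)
Definition univ_shift (i : 'I_n) F : {mpoly {mpoly k[M]}[N.+1]} :=
  mmap (@mpolyC N.+1 {mpoly k[M]} \o @mpolyC M k)
    (fun j => 'X_j + ('X_(mxvec_index i j))%:MP) F.

Lemma mheval_univ_shift i F x u :
  mheval (univ_shift i F)@_u x = (shift (hcoord (tnth x i)) F)@_u.
Proof.
rewrite mhevalE; set y := mxvec _ 0.
rewrite -(mcoeff_map_mpoly (meval y)) /univ_shift; congr (_@_u).
rewrite -[LHS]/((map_mpoly (meval y) : {rmorphism _ -> _}) _) rmorph_mmap; apply: eq_mmap => [c|j] /=.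
  by rewrite map_mpolyC /= mevalC.
by rewrite rmorphD /= map_mpolyX map_mpolyC /= mevalXU /y mxvecE mxE.
Qed.

Lemma multideg_univ_shift i d F u : F \is d.-homog ->
  multideg (fun i' => (i' == i) * (d - mdeg u))%N (univ_shift i F)@_u.
Proof.
(* Total degree [D] in the variables together with the coordinates of the [i]-th point, and degree 0
   in those of the other points. *)
pose hm D (Q : {mpoly {mpoly k[M]}[N.+1]}) := forall u c, Q@_u@_c != 0 -> forall i',
  (\sum_j c (mxvec_index i' j) + (i' == i) * mdeg u)%N = ((i' == i) * D)%N.
have hmM D D' Q Q' : hm D Q -> hm D' Q' -> hm (D + D')%N (Q * Q').
  move=> hQ hQ' w c; rewrite mcoeffM raddf_sum /= => nz.
  have [w12 /eqP Ew nz1] : exists2 w12 : 'X_{1..N.+1 < (mdeg w).+1, (mdeg w).+1},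
      w == (w12.1 + w12.2)%MM & (Q@_w12.1 * Q'@_w12.2)@_c != 0.
    apply: contrapT => H; case/eqP: nz; rewrite big1 // => w12 Ew; apply/eqP.
    by apply: contrapT => /negP nz; apply: H; exists w12.
  move: nz1; rewrite -mcoeff_msupp => /msuppM_le/allpairsP[[c1 c2]] /=.
  rewrite !mcoeff_msupp => -[/hQ e1 /hQ' e2 ->] i'.
  have -> : mdeg w = (mdeg w12.1 + mdeg w12.2)%N by rewrite [in LHS]Ew mdegD.
  rewrite [RHS]mulnDr -e1 -e2 mulnDr addnACA -big_split /=; congr (_ + _)%N.
  by apply: eq_bigr => j _; rewrite mnmDE.
have hmD D Q Q' : hm D Q -> hm D Q' -> hm D (Q + Q').
  move=> hQ hQ' w c; rewrite !mcoeffD.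
  have [->|/hQ H _] := eqVneq (Q@_w@_c) 0; last exact: H.
  rewrite add0r; exact: hQ'.
have hmC (c : {mpoly k[M]}) e : (forall i', e i' = (i' == i) * e i)%N ->
    multideg e c -> hm (e i) c%:MP.
  move=> ee ec w b; rewrite mcoeffC; have [->|] := eqVneq w 0%MM; last first.
    by rewrite mulr0 mcoeff0 eqxx.
  by rewrite mulr1 => /ec H i'; rewrite mdeg0 muln0 addn0 H ee.
have hmC0 c : hm 0%N (c%:MP)%:MP.
  apply: (hmC _ (fun=> 0%N)) => [i'|]; first by rewrite muln0.
  exact: multidegC.
have hmX j : hm 1%N ('X_j + ('X_(mxvec_index i j))%:MP).
  apply: hmD.
    move=> w b; rewrite mcoeffX; have [<-|_] := eqVneq U_(j)%MM w; last first.
      by rewrite mcoeff0 eqxx.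
    rewrite mcoeff1; have [->|_] := eqVneq b 0%MM; last by rewrite eqxx.
    by move=> _ i'; rewrite mdeg1 big1 // => j' _; rewrite mnm0E.
  have := hmC 'X_(mxvec_index i j) (fun i' => (i' == i) : nat); rewrite eqxx; apply.
    by move=> i'; rewrite muln1.
  exact: multidegX.
have hm0 D : hm D 0 by move=> w c; rewrite !mcoeff0 eqxx.
have hmXn D j Q : hm D Q -> hm (j * D)%N (Q ^+ j).
  move=> hQ; elim: j => [|j IH]; first exact: (hmC0 1).
  by rewrite exprS mulSn; apply: hmM.
move=> /dhomogP Fd; suff hF : hm d (univ_shift i F).
  move=> c /hF H i'; have := H i'; case: (i' == i); rewrite ?mul0n ?mul1n ?addn0 //.
  by move=> <-; rewrite addnK.
rewrite /univ_shift /mmap big_seq; elim/big_ind: _; [exact: hm0|exact: hmD|].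
move=> w /Fd <-; apply: (hmM 0%N (mdeg w)); first exact: hmC0.
rewrite mdegE /mmap1; elim/big_rec2: _ => [|j Q d' _ hQ]; first exact: (hmC0 1).
by apply: hmM => //; have := hmXn 1%N (w j) _ (hmX j); rewrite muln1.
Qed.

(* The conditions defining the complement of [no_form] are linear in the
   coefficients of the form, so some maximal minor does not vanish at [x]. *)
Lemma no_form_nbhd d m x : no_form d m x ->
  exists G, [/\ multihomog G, mheval G x != 0
    & forall y, mheval G y != 0 -> no_form d m y].
Proof.
move=> nx; have [B [Bd Bspan Bfree]] := dhomog_basis k N d.
(* [K] bounds every [m i], so the exponents range over a finite type; the rows with [m i <= mdeg u]
   are set to zero. *)
pose K := (\sum_i m i)%N.
pose rows : finType := ('I_n * 'X_{1..N.+1 < K})%type.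
pose E (r : 'I_#|rows|) c : {mpoly k[M]} :=
  let: (i, u) := enum_val r in
  if (mdeg u < m i)%N then (univ_shift i (B c))@_u else 0.
pose A (y : pspace_pow k N n) : 'M[k]_(#|rows|, 'C(d + N, d)) := \matrix_(r, c) mheval (E r c) y.
have AE y (w : 'cV_('C(d + N, d))) r : (A y *m w) r 0 =
    let: (i, u) := enum_val r in
    if (mdeg u < m i)%N then
      (shift (hcoord (tnth y i)) (\sum_c w c 0 *: B c))@_u else 0.
  rewrite mxE; under eq_bigr => c _ do rewrite mxE /E.
  case: (enum_val r) => i u; case: ifP => _; last first.
    by rewrite big1 // => c _; rewrite /mheval meval0 mul0r.
  rewrite [shift _ _]raddf_sum raddf_sum /=; apply: eq_bigr => c _.
  by rewrite mmapZ /= mcoeffCM mulrC mheval_univ_shift.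
have full : row_full (A x).
  rewrite /row_full -mxrank_tr -/(row_free _) -kermx_eq0.
  apply: contraPT nx => /rowV0Pn[w /sub_kermxP wA w0] nx.
  have Aw : A x *m w^T = 0 by rewrite -[A x]trmxK -trmx_mul wA trmx0.
  apply: (nx (\sum_c w 0 c *: B c)); last first.
  - move=> i u um; have uK : (mdeg u < K)%N.
      by apply: leq_trans um _; rewrite /K (bigD1 i) //= leq_addr.
    have := AE x w^T (enum_rank (i, BMultinom uK)); rewrite Aw mxE enum_rankK /= um => ->.
    by congr (shift _ _)@_u; apply: eq_bigr => c _; rewrite mxE.
  - by apply: rpred_sum => c _; apply: dhomogZ (Bd c).
  - apply: contraNneq w0 => /Bfree H; apply/eqP/rowP => c; by rewrite H mxE.
pose f := fullrankfun full.
pose G := \det (\matrix_(r, c) E (f r) c).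
have GE y : mheval G y = \det (rowsub f (A y)).
  rewrite /mheval -[LHS]/((meval _ : {rmorphism _ -> _}) _) -det_map_mx; congr (\det _).
  by apply/matrixP => r c; rewrite !mxE.
exists G; split.
- pose e (r : 'I_('C(d + N, d))) i' :=
    let: (i, u) := enum_val (f r) in ((i' == i) * (d - mdeg u))%N.
  apply: (multideg_multihomog (e := fun i' => (0 + \sum_r e r i')%N)).
  apply: multideg_sum => s; apply: multidegM.
    have -> : (-1) ^+ perm.odd_perm s = ((-1) ^+ perm.odd_perm s)%:MP :> {mpoly k[M]} by rewrite rmorph_sign.
    exact: multidegC.
  apply: multideg_prod => r; rewrite mxE /E /e; case: (enum_val _) => i u.
  by case: ifP => _; [apply: multideg_univ_shift|apply: multideg0].
- by rewrite GE -unitfE -unitmxE fullrowsub_unit.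
move=> y Gy F F0 Fd Fv; have [u Fu] := Bspan F Fd.
pose w : 'cV_('C(d + N, d)) := \col_c u c.
have Fw : F = \sum_c w c 0 *: B c by rewrite Fu; apply: eq_bigr => c _; rewrite mxE.
have : rowsub f (A y) *m w = 0.
  apply/matrixP => r j; rewrite ord1 mul_rowsub_mx !mxE.
  have := AE y w (f r); rewrite mxE => ->; case: (enum_val _) => i v; rewrite -Fw.
  by case: ifP => // vm; apply: Fv.
move=> /(congr1 (mulmx (invmx (rowsub f (A y))))); rewrite mulmx0 mulKmx; last first.
  by rewrite unitmxE unitfE -GE.
move=> w0; case/eqP: F0; rewrite Fw big1 // => c _.
by rewrite w0 mxE scale0r.
Qed.

End Forms.

(** * Existence of tuples that carry no form of excess multiplicity *)

Lemma vanishes_hcoord_line_point (k : fieldType) (N d m : nat) (v : 'I_N.+1 -> k)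
    (F : {mpoly k[N.+1]}) : F \is d.-homog -> (exists j, v j != 0) ->
  vanishes m (hcoord (line_point (\row_j v j))) F -> vanishes m v F.
Proof.
move=> Fd [j vj]; have [|c c0 cE] := @hcoord_line_point _ _ (\row_j v j).
  by apply: contraNneq vj => /rowP/(_ j); rewrite !mxE => ->.
move=> /(vanishes_scale Fd (invr_neq0 c0)).
rewrite (_ : (fun i => _) = v) //; apply/funext => i.
by rewrite cE mxE mulKf.
Qed.

Lemma exists_no_form (k : fieldType) (N n s d : nat) (m : 'I_n -> nat) :
  [pchar k] =i pred0 -> (0 < N)%N -> (N <= s)%N -> ('C(s, N) <= n)%N ->
  (d * n * N < s * \sum_i m i)%N -> exists x : pspace_pow k N n, no_form d m x.
Proof.
move=> char0 N0 Ns tn dm; apply: contrapT => H.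
case: n => [|n] in m tn dm H *; first by rewrite big_ord0 !muln0 ltn0 in dm.
have {}H (y : pspace_pow k N n.+1) : exists F : {mpoly k[N.+1]}, [/\ F != 0, F \is d.-homog
    & forall i, vanishes (m i) (hcoord (tnth y i)) F].
  apply: contrapT => H1; apply: H; exists y => F F0 Fd Fv.
  by apply: H1; exists F.
pose sets := enum [set J : {set 'I_s} | #|J| == N]%SET.
(* Each [N]-subset occurs once; spare indices, if any, get the empty set. *)
pose J i := nth finset.set0 sets i.
pose a (i : 'I_s) : k := (i : nat)%:R.
pose X : pspace_pow k N n.+1 := [tuple line_point (\row_j star_point a (J i) j) | i < n.+1].
(* At the [j]-th point of [X], the form [F r] of the cyclic shift by [r] vanishes to order
   [m (j - r)]; over all [r] these add up to the full sum. *)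
have /choice[F HF] (r : 'I_n.+1) := H [tuple tnth X (i + r) | i < n.+1].
pose P := \prod_r F r; pose w := (\sum_i m i)%N.
have P0 : P != 0 by apply/prodf_neq0 => r _; have [] := HF r.
have Pd : P \is (n.+1 * d).-homog.
  rewrite -[n.+1]card_ord -sum_nat_const /P; elim/big_rec2: _ => [|r e Q _ Qe].
    exact: dhomog1.
  by apply: dhomogM => //; have [] := HF r.
have Pv j : vanishes w (hcoord (tnth X j)) P.
  have -> : w = (\sum_r m (j - r)%R)%N by rewrite /w (reindex_inj (subrI j)).
  apply: vanishes_prod => r; have [_ _ /(_ (j - r))] := HF r.
  by rewrite tnth_mktuple subrK.
have ainj : injective a by move=> i j /natr_inj-/(_ char0) /val_inj.
have card_sets : size sets = 'C(s, N) by rewrite -cardE card_draws card_ord.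
have := @star_inequality k _ a N (n.+1 * d) finset.setT (fun=> w) P char0 ainj P0 Pd.
rewrite (eq_bigl (mem [set J : {set 'I_s} | #|J| == N]%SET)); last first.
  by move=> A; rewrite finset.subsetT /= !inE.
rewrite sum_nat_const card_draws cardsT card_ord.
have -> : (if N is n'.+1 then 'C(s.-1, n') else 0%N) = 'C(s.-1, N.-1) by case: (N) N0.
have HJ : forall A : {set 'I_s}, A \subset finset.setT -> #|A| = N -> vanishes w (star_point a A) P.
  move=> A _ cA; have As : A \in sets by rewrite mem_enum inE cA.
  have iA : (index A sets < n.+1)%N by rewrite (leq_trans _ tn) // -card_sets index_mem.
  apply: (vanishes_hcoord_line_point Pd).
    exists ord_max; rewrite /star_point /= -cA; set Q := \prod_(j in A) _.
    have sQ : size Q = #|A|.+1 by rewrite /Q -big_enum size_prod_XsubC -cardE.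
    have : lead_coef Q = 1 by apply/monicP; apply: monic_prod_XsubC.
    by rewrite /lead_coef sQ /= => ->; rewrite oner_neq0.
  have := Pv (Ordinal iA); rewrite tnth_mktuple /J /= nth_index //.
move=> /(_ HJ) le1.
(* By this identity, [le1] multiplied by [s] contradicts [dm] multiplied by ['C(s, N)]. *)
have bs : (s * 'C(s.-1, N.-1) = N * 'C(s, N))%N by rewrite mul_bin_diag prednK.
have C0 : (0 < 'C(s, N))%N by rewrite bin_gt0.
move: dm; rewrite ltnNge -(leq_pmul2l C0) => /negP; apply.
rewrite mulnCA; apply: leq_trans (leq_mul (leqnn s) le1) _.
by rewrite mulnCA bs; lia.
Qed.

(** * Multiplicity at a point compared with order of vanishing *)

Section Multiplicity.
Variables (k : fieldType) (N : nat).
Hypothesis char0 : [pchar k] =i pred0.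
Implicit Types (p : pspace k N) (F : {mpoly k[N.+1]}).

Lemma point_idealP p F c : point_ideal p F -> F.@[fun j => c * hcoord p j] = 0.
Proof.
move=> Fp; have := Fp (c *: vpick (val p)); rewrite memvZ ?memv_pick // => /(_ isT) <-.
by apply: meval_eq => j; rewrite mxE.
Qed.

(** A product of [m] elements of the point ideal vanishes to order [m] along the line of [p]. The
    multiplier [g] is cancelled at a vector of that line where it is nonzero, and homogeneity of [F]
    carries the order back to [hcoord p]. *)
Lemma symbolic_power_vanishes d m p F : F \is d.-homog ->
  symbolic_power p m F -> vanishes m (hcoord p) F.
Proof.
move=> Fd [g ng [s sI E]].
(* [g] need not be homogeneous and may vanish at [hcoord p] itself, hence the general multiple
   [t]. *)
have [t t0 gt] : exists2 t, t != 0 & g.@[fun j => t * hcoord p j] != 0.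
  have /existsNP[v /not_implyP[/line_pointP[c ->] gv]] := ng.
  pose q := line_restr g (fun=> 0) (hcoord p).
  have qE t : q.[t] = g.@[fun j => t * hcoord p j].
    by rewrite horner_line_restr; apply: meval_eq => j; rewrite add0r.
  have q0 : q != 0.
    apply/eqP => q0; apply: gv; have := qE c; rewrite q0 horner0 => E0.
    by rewrite [RHS]E0; apply: meval_eq => j; rewrite mxE.
  have [[]|t Ht] := common_nonroots_fin char0 (p := fun b : bool => if b then q else 'X).
  - by [].
  - by rewrite polyX_eq0.
  by exists t; rewrite -?qE; [have := Ht false; rewrite hornerX|exact: (Ht true)].
have : vanishes m (fun j => t^-1 * (t * hcoord p j)) F.
  apply: vanishes_scale Fd (invr_neq0 t0) _; apply: vanishes_cancel gt _; rewrite E.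
  apply: vanishes_sum => u us; apply: (@vanishesM _ _ 0 m); first exact: vanishes0.
  rewrite -[X in vanishes X](card_ord m) -sum1_card; apply: vanishes_prod => i.
  by apply/vanishes1/point_idealP/sI.
by rewrite (_ : (fun j => _) = hcoord p) //; apply/funext => j; rewrite mulKf.
Qed.

Lemma mult_vanishes d p F : F \is d.-homog -> vanishes (mult p F) (hcoord p) F.
Proof.
(* If [xget] falls back to 0, vanishing to order 0 is automatic. *)
move=> Fd; rewrite /mult; case: xgetP => [m _ [sm _]|_ ]; last exact: vanishes0.
exact: symbolic_power_vanishes Fd sm.
Qed.

(** A form in all symbolic powers would vanish to order [d.+1], beyond its degree, so [xget] finds
    an index; membership in the first symbolic power excludes the index 0. *)
Lemma mult_gt0 d p F : F != 0 -> F \is d.-homog -> point_ideal p F -> (0 < mult p F)%N.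
Proof.
move=> F0 Fd Fp.
have s1 : symbolic_power p 1 F.
  exists 1; first by move=> p1; have /eqP := point_idealP 0 p1; rewrite meval1 oner_eq0.
  exists [:: (1, [tuple F])] => [u|]; first by rewrite inE => /eqP -> i; rewrite (tnth_nth 0) ord1.
  by rewrite big_seq1 big_ord1 /= !mul1r.
have [m [sm nm]] : exists m, symbolic_power p m F /\ ~ symbolic_power p m.+1 F.
  apply: contrapT => /forallNP H; suff sm m : symbolic_power p m.+1 F.
    by have := vanishes_le_deg char0 F0 Fd (symbolic_power_vanishes Fd (sm d)); rewrite ltnn.
  by elim: m => [//|m IH]; apply: contrapT => nm; apply: (H m.+1).
rewrite /mult; case: xgetP => [m' _ [sm' nm']|/(_ m)]; last by move=> [].
by case: m' sm' nm' => [|m'] // _ [].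
Qed.
End Multiplicity.

(** * Counting conditions and reduction of the Seshadri bound *)

Lemma exists_hypersurface_through (k : fieldType) (N n d : nat) (X : n.-tuple (pspace k N)) :
  (0 < d)%N -> (n < 'C(d + N, d))%N -> hypersurface_through X d.
Proof.
move=> d0 nd; have [B [Bd Bspan Bfree]] := dhomog_basis k N d.
pose A := \matrix_(r < 'C(d + N, d), i < n) (B r).@[hcoord (tnth X i)].
have /rowV0Pn[u /sub_kermxP uA u0] : kermx A != 0.
  by rewrite kermx_eq0 /row_free neq_ltn (leq_ltn_trans (rank_leq_col A)).
have Fd : \sum_r u 0 r *: B r \is d.-homog.
  by apply: rpred_sum => r _; apply: dhomogZ (Bd r).
exists (\sum_r u 0 r *: B r).
  split=> //; apply: contraNneq u0 => /Bfree H.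
  by apply/eqP/rowP => r; rewrite H mxE.
move=> p /tnthP[i ->] v /line_pointP[c ->].
have -> : (\sum_r u 0 r *: B r).@[(c *: vpick (val (tnth X i))) 0] =
          c ^+ d * (\sum_r u 0 r *: B r).@[hcoord (tnth X i)].
  rewrite -[RHS](mmap_scale idfun c (hcoord (tnth X i)) Fd).
  by apply: eq_mmap => // j; rewrite mxE.
rewrite raddf_sum /=; under eq_bigr do rewrite mevalZ.
have := congr1 (fun M : 'rV_n => M 0 i) uA; rewrite !mxE.
move=> E; rewrite (eq_bigr (fun j => u 0 j * A j i)) => [|j _]; last by rewrite [A j i]mxE.
by rewrite E mulr0.
Qed.

Lemma alpha_leq (k : fieldType) (N n d : nat) (X : n.-tuple (pspace k N)) :
  (0 < d)%N -> (n < 'C(d + N, d))%N -> (alpha X <= d)%N.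
Proof.
move=> d0 nd; rewrite /alpha; case: xgetP => [e _ [_ H]|//].
exact/H/exists_hypersurface_through.
Qed.

(** The least degree in which counting conditions forces a hypersurface through [n] points. By
    minimality, [d.-1 + N] hyperplanes in general position have at most [n] star points. *)
Lemma initial_degree (N n : nat) : (0 < N)%N -> (0 < n)%N ->
  exists d, [/\ (0 < d)%N, (n < 'C(d + N, d))%N & ('C(d.-1 + N, N) <= n)%N].
Proof.
move=> N0 n0; have ex : exists d, (n < 'C(d + N, d))%N.
  exists n; apply: leq_trans (leq_bin2l n (_ : n.+1 <= n + N)%N).
    by rewrite binSn.
  by rewrite -addn1 leq_add2l.
case: (ex_minnP ex) => d nd mind; exists d.
have d0 : (0 < d)%N by case: d nd {mind} => //; rewrite bin0 ltnS leqNgt n0.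
split=> //; rewrite -bin_sub ?leq_addl // addnK leqNgt; apply/negP => /mind.
by rewrite leqNgt prednK // leqnn.
Qed.

(** The absence of forms bounds each ratio below by [(a.-1 + N) / (n * N)], and [alpha X <= a];
    taking the root is monotone. *)
Lemma seshadri_lower_bound (R : realType) (k : fieldType) (N n a : nat)
    (X : n.-tuple (pspace k N)) :
  [pchar k] =i pred0 -> (0 < N)%N -> (0 < n)%N -> (0 < a)%N -> (n < 'C(a + N, a))%N ->
  (forall d m, (d * n * N < (a.-1 + N) * \sum_i m i)%N -> no_form d m X) ->
  (((alpha X)%:R + N%:R - 1) / (n%:R * N%:R)) `^ (N.-1%:R)^-1 <= seshadri R X.
Proof.
move=> char0 N0 n0 a0 na good.
have -> : (alpha X)%:R + N%:R - 1 = (alpha X + N - 1)%:R :> R.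
  by rewrite natrB ?natrD // addn_gt0 N0 orbT.
have lb : forall r : R, (exists d (F : {mpoly k[N.+1]}),
    [/\ hypersurface d F, exists2 p, p \in X & point_ideal p F
      & r = d%:R / (\sum_(p <- X) mult p F)%:R]) ->
    (alpha X + N - 1)%:R / (n%:R * N%:R) <= r.
  move=> r [d [F [[F0 d0 Fd] [p pX Fp] ->]]].
  set m := (\sum_(p <- X) mult p F)%N.
  have m0 : (0 < m)%N.
    by rewrite /m (big_rem p) //= addn_gt0 (mult_gt0 char0 F0 Fd Fp).
  have le1 : ((a.-1 + N) * m <= d * n * N)%N.
    rewrite leqNgt; apply/negP => lt1.
    have := good d (fun i => mult (tnth X i) F).
    rewrite -(big_tuple _ _ X xpredT (fun p => mult p F)) => /(_ lt1 F F0 Fd); apply=> i.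
    exact: mult_vanishes Fd.
  have le2 := alpha_leq X a0 na.
  rewrite ler_pdivrMr ?mulr_gt0 ?ltr0n // mulrAC ler_pdivlMr ?ltr0n //.
  rewrite -!natrM ler_nat mulnA; apply: leq_trans le1.
  by rewrite leq_mul2r; apply/orP; right; lia.
(* A lower bound passes to [inf] only for a nonempty set; a hypersurface of degree [a] through all
   the points supplies an element. *)
have ne : [set r : R | exists d (F : {mpoly k[N.+1]}),
    [/\ hypersurface d F, exists2 p, p \in X & point_ideal p F
      & r = d%:R / (\sum_(p <- X) mult p F)%:R]] !=set0.
  have [F hF Fv] := exists_hypersurface_through X a0 na.
  eexists; exists a, F; split=> //.
  exists (tnth X (Ordinal n0)); first exact: mem_tnth.
  exact/Fv/mem_tnth.
have le := lb_le_inf ne lb; rewrite /seshadri.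
have ge0 : 0 <= (alpha X + N - 1)%:R / (n%:R * N%:R) :> R.
  by rewrite divr_ge0 ?mulr_ge0 ?ler0n.
by apply: ge0_ler_powR => //; rewrite ?invr_ge0 ?ler0n // nnegrE // (le_trans ge0).
Qed.

(** * Very general tuples over uncountable and countable fields *)

Section VeryGeneral.
Variables (k : fieldType) (N n : nat).
Hypothesis char0 : [pchar k] =i pred0.
Implicit Types (x y : pspace_pow k N n).

(** Asking for all permutations of [m] makes the set symmetric, so that it descends to cycles. *)
Definition no_form_sym (d : nat) (m : 'I_n -> nat) : set (pspace_pow k N n) :=
  [set x | forall s : 'S_n, no_form d (m \o s) x].

Lemma no_form_sym_symmetric d m : symmetric_set (no_form_sym d m).
Proof.
move=> x y; rewrite perm_sym => /tuple_permP[t yE] nx s F F0 Fd Fv.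
apply: (nx (t^-1 * s)%g F) => // i.
have := Fv ((t^-1)%g i); rewrite /= permM.
rewrite (tnth_nth (tnth x i)) yE -tnth_nth tnth_mktuple permKV //.
Qed.

Lemma open_no_form_sym d m : open (no_form_sym d m).
Proof.
apply/zariski_openP => x nx.
have /choice[G HG] (s : 'S_n) := no_form_nbhd (nx s).
exists (\prod_s G s); split.
- by apply: multihomog_prod => s; have [] := HG s.
- by rewrite mheval_prod; apply/prodf_neq0 => s _; have [] := HG s.
move=> y; rewrite mheval_prod => /prodf_neq0 Gy s.
by have [_ _] := HG s; apply; apply: Gy.
Qed.

Lemma common_point_open (T : Type) (i0 : T) (V : T -> set (pspace_pow k N n)) :
  common_nonroots k T -> (forall i, open (V i)) -> (forall i, V i !=set0) ->
  exists x, forall i, V i x.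
Proof.
move=> cnr oV V0.
have /choice[G HG] i : exists G, [/\ multihomog G, exists x, mheval G x != 0
    & forall y, mheval G y != 0 -> V i y].
  have [x Vx] := V0 i; have /zariski_openP/(_ x Vx)[G [mG Gx GV]] := oV i.
  by exists G; split=> //; exists x.
have [||x Hx] := @common_point _ _ _ T i0 G char0 cnr.
- by move=> i; have [] := HG i.
- by move=> i; have [] := HG i.
by exists x => i; have [_ _] := HG i; apply.
Qed.

(** Permuting [m] keeps its sum, so each of finitely many open conditions is satisfiable, and
    together they have a common point. *)
Lemma no_form_sym_neq0 d m s : (0 < N)%N -> (N <= s)%N -> ('C(s, N) <= n)%N ->
  (d * n * N < s * \sum_i m i)%N -> no_form_sym d m !=set0.
Proof.
move=> N0 Ns sn dm; apply: (@common_point_open 'S_n 1%g (fun t => [set x | no_form d (m \o t) x])).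
- exact: common_nonroots_fin.
- by move=> t; apply/zariski_openP => x; apply: no_form_nbhd.
move=> t; apply: (@exists_no_form _ _ _ s) => //.
by rewrite (reindex_inj (@perm_inj _ t)) in dm.
Qed.

Lemma very_general_open (T : countType) (V : T -> set (pspace_pow k N n))
    (P : n.-tuple (pspace k N) -> Prop) :
  (forall i, open (V i)) -> (forall i, symmetric_set (V i)) ->
  (exists x, forall i, V i x) ->
  (forall x, uniq x -> (forall i, V i x) -> P x) -> very_general P.
Proof.
move=> oV sV [x0 Vx0] VP.
(* Numbers that encode no element of [T] give the whole space. *)
pose V' i := if unpickle i is Some j then V j else setT.
have sV' i : symmetric_set (V' i) by rewrite /V'; case: (unpickle i) => [j|] //; apply: sV.
have oV' i : open (V' i) by rewrite /V'; case: (unpickle i) => [j|]; [apply: oV|apply: openT].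
have V'x0 i : V' i x0 by rewrite /V'; case: (unpickle i) => [j|].
exists (fun i => cycles (V' i)); split=> [i||x ux Hx].
- split; first exact: open_cycles.
  by apply: dense_cycles => //; exists x0.
- by exists (cycle_of x0) => i _; apply/cycles_cycle_of.
apply: VP => // j; have := Hx (pickle j) Logic.I.
by move/(cycles_cycle_of _ (sV' _)); rewrite /V' pickleK.
Qed.

End VeryGeneral.

(* Over a countable field a single cycle, here [n] times the point
   (1 : 0 : ... : 0), is a countable intersection of dense open sets. *)
Lemma countable_multiple_point (k : fieldType) (N n : nat) :
  [pchar k] =i pred0 -> countable [set: k] -> (0 < n)%N ->
  very_general (fun X : n.-tuple (pspace k N) => n = 1%N).
Proof.
move=> char0 /countable_injP[f finj] n0.
pose g i : k := xget 0 [set c | f c = i].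
have gK c : g (f c) = c.
  by apply: finj; rewrite ?inE // /g; case: xgetP => [x _ //|/(_ c) []].
(* [phi (l, i)] vanishes where coordinate 0 is [g i] times coordinate [l.+1]. As [g] hits all of
   [k], avoiding all these loci leaves only (1 : 0 : ... : 0). *)
pose phi (li : 'I_N * nat) (p : pspace k N) :=
  hcoord p ord0 - g li.2 * hcoord p (lift ord0 li.1).
pose V li := [set x : pspace_pow k N n | \prod_(p <- x) phi li p != 0].
pose G (li : 'I_N * nat) : {mpoly k[(n * N.+1)%N]} := \prod_(j < n)
  ('X_(mxvec_index j ord0) + (- g li.2)%:MP * 'X_(mxvec_index j (lift ord0 li.1))).
have GE li x : mheval (G li) x = \prod_(p <- x) phi li p.
  rewrite mheval_prod big_tuple; apply: eq_bigr => j _.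
  by rewrite mhevalE mevalD mevalM mevalC !mevalXU !mxvecE !mxE mulNr.
have mG li : multihomog (G li).
  apply: (multideg_multihomog (e := fun i => \sum_(j < n) (i == j))%N).
  apply: multideg_prod => j; apply: multidegD; first exact: multidegX.
  have := multidegM (@multidegC k N n (- g li.2)) (@multidegX k N n j (lift ord0 li.1)).
  exact.
apply: (very_general_open char0 (V := V)) => //.
- move=> li; apply/zariski_openP => x Vx; exists (G li); split=> //; first by rewrite GE.
  by move=> y; rewrite GE.
- by move=> li x y xy; rewrite /V /= (perm_big _ xy).
- pose M : 'M[k]_(n, N.+1) := \matrix_(i, j) (j == ord0)%:R.
  have Mr i : row i M != 0.
    by apply/eqP => /rowP/(_ ord0)/eqP; rewrite !mxE eqxx oner_eq0.
  exists (tuple_of_rows M) => li; suff : mheval (G li) (tuple_of_rows M) != 0 by rewrite GE.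
  rewrite mheval_tuple_of_rows //.
  rewrite rmorph_prod; apply/prodf_neq0 => j _.
  rewrite /= mevalD mevalM mevalC !mevalXU !mxvecE !mxE eqxx.
  by rewrite [lift _ _ == _]eq_sym (negbTE (neq_lift _ _)) mulr0 addr0 oner_neq0.
move=> x ux Vx.
have Hx i l : hcoord (tnth x i) (lift ord0 l) = 0.
  apply/eqP/negPn/negP => h.
  have := Vx (l, f (hcoord (tnth x i) ord0 / hcoord (tnth x i) (lift ord0 l))).
  rewrite /V /= big_tuple => /prodf_neq0 /(_ i isT).
  by rewrite /phi /= gK divfK // subrr eqxx.
(* With two or more entries the tuple would repeat a point, against [uniq x]. *)
case: n n0 x ux {Vx V G GE mG} Hx => [//|[//|n]] _ x ux Hx.
have E i j : tnth x i = tnth x j.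
  apply: (@proportional_points _ _ _ _ (hcoord (tnth x i) ord0 / hcoord (tnth x j) ord0)).
  have h0 : hcoord (tnth x j) ord0 != 0.
    apply/eqP => h0; have := vpick_point_neq0 (tnth x j); case/eqP; apply/rowP => l.
    by rewrite mxE; case: (unliftP ord0 l) => [l' ->|-> //]; apply: Hx.
  apply/rowP => l; rewrite mxE; case: (unliftP ord0 l) => [l' ->|->]; last by rewrite divfK.
  by rewrite [LHS]Hx [X in _ * X]Hx mulr0.
have /(_ _ _ (E ord0 ord_max)) := tuple_uniqP _ ux.
by [].
Qed.

Theorem corollary2p10 (R : realType) (k : closedFieldType)
  (char0 : [pchar k] =i pred0) (N n : nat) (N_ge2 : (2 <= N)%N)
  (n_ge1 : (1 <= n)%N) :
  very_general (fun X : n.-tuple (pspace k N) =>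
    (((alpha X)%:R + N%:R - 1) / (n%:R * N%:R)) `^ (N.-1%:R)^-1
      <= seshadri R X).
Proof.
have N0 : (0 < N)%N by apply: ltnW.
have [a [a0 na an]] := initial_degree N0 n_ge1.
(* [common_nonroots_count] needs an uncountable field; over a countable one,
   [countable_multiple_point] reduces to [n = 1]. *)
have [ck|uk] := pselect (countable [set: k]).
  have [U [oU U0 HU]] := countable_multiple_point N char0 ck n_ge1.
  exists U; split=> // X uX UX; apply: seshadri_lower_bound na _ => //.
  move=> d m dm F F0 Fd Fv; have n1 := HU X uX UX; subst n.
  (* For one point [a = 1], and what remains is that an order of vanishing is at most the degree. *)
  have a1 : a.-1 = 0%N.
    case: a.-1 an => [//|b] /(leq_trans (leq_bin2l N (_ : N.+1 <= b.+1 + N)%N)).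
    by rewrite binSn ltnS leqn0 => /(_ (leq_addl b N)); case: (N) N0.
  move: dm; rewrite a1 add0n muln1 mulnC ltn_pmul2l // big_ord1 ltnNge => /negP; apply.
  exact: vanishes_le_deg (Fv ord0).
(* The pairs of a degree and a tuple of multiplicities form a countable type; where the inequality
   fails, no condition is imposed. *)
pose V (dm : nat * n.-tuple nat) : set (pspace_pow k N n) :=
  if (dm.1 * n * N < (a.-1 + N) * \sum_i tnth dm.2 i)%N then
  no_form_sym dm.1 (tnth dm.2) else setT.
have oV dm : open (V dm).
  by rewrite /V; case: ifP => _; [apply: open_no_form_sym|apply: openT].
apply: (very_general_open char0 (V := V)) => //.
- move=> dm; rewrite /V; case: ifP => _ //; exact: no_form_sym_symmetric.
- apply: (common_point_open char0 (0%N, [tuple of nseq n 0%N])) => //.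
    exact: common_nonroots_count.
  move=> dm; rewrite /V; case: ifP => [lt|_].
    by apply: (no_form_sym_neq0 char0 N0 (leq_addl _ _) an lt).
  by exists (tuple_of_rows 0).
move=> X _ VX; apply: seshadri_lower_bound na _ => // d m dm.
have := VX (d, [tuple m i | i < n]); rewrite /V /=.
under eq_bigr do rewrite tnth_mktuple.
rewrite dm => /(_ 1%g); congr (no_form _ _ _).
by apply/funext => i; rewrite /= perm1 tnth_mktuple.
Qed.
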